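(* Let $n\ge2$ be an integer. Fix a disk with six boundary points $p_1,\dots,p_6$ in cyclic order, and a fixed exterior, and consider unoriented planar $4$-valent graphs which agree outside the disk and which inside the disk are one of the following. $T$: three vertices, every two of them joined by one edge so as to bound an empty triangular face, with outer ends going to $\{p_1,p_2\}$, $\{p_3,p_4\}$, $\{p_5,p_6\}$ respectively. $T'$: the same, with outer ends going to $\{p_2,p_3\}$, $\{p_4,p_5\}$, $\{p_6,p_1\}$ respectively. $V_{i,i+1}$ (indices mod $6$): an arc joining $p_i$ and $p_{i+1}$, disjoint from a single vertex joined by four edges to the remaining four boundary points. $M$: three disjoint arcs joining $p_1p_2$, $p_3p_4$, $p_5p_6$. $M'$: three disjoint arcs joining $p_2p_3$, $p_4p_5$, $p_6p_1$. Then $$\langle\!\langle T\rangle\!\rangle+\langle\!\langle V_{4,5}\rangle\!\rangle-\langle\!\langle V_{3,4}\rangle\!\rangle-\langle\!\langle V_{5,6}\rangle\!\rangle-[2n-4]\,\langle\!\langle M\rangle\!\rangle=\langle\!\langle T'\rangle\!\rangle+\langle\!\langle V_{1,2}\rangle\!\rangle-\langle\!\langle V_{2,3}\rangle\!\rangle-\langle\!\langle V_{6,1}\rangle\!\rangle-[2n-4]\,\langle\!\langle M'\rangle\!\rangle .$$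
   Context: Throughout, $n\ge 2$ is an integer, $q$ is a formal variable, and $[m]=\frac{q^m-q^{-m}}{q-q^{-1}}$ for $m\in\mathbb Z$. Graphs. A planar $4$-valent graph is embedded in $\mathbb R^2$, considered up to planar isotopy; it may have loops, multiple edges, several components, and components that are circles without vertices. An orientation of all edges (and circles) is balanced if every vertex has two incoming and two outgoing edge-ends. A vertex is then crossing-type if in cyclic order the ends are in, in, out, out, and alternating if they are in, out, in, out. Local relations relate graphs that are identical outside a disk. MOY graph polynomial. For oriented planar $4$-valent graphs $\Gamma$ all of whose vertices are crossing-type, $R(\Gamma)\in\mathbb Z[q,q^{-1}]$ is the (well-defined, unique) planar-isotopy-invariant function with $R(\emptyset)=1$ and satisfying the following local relations. (i) A circle without vertices bounding an empty disk may be removed with factor $[n]$. (ii) A vertex having a loop edge that bounds an empty disk may be replaced by an arc with factor $[n-1]$. (iii) An empty bigon face whose two edges are both directed from one vertex to the other equals $[2]$ times the graph with the bigon collapsed to a single vertex. (iv) An empty bigon face with vertices $v,w$ and edges $v\to w$, $w\to v$ equals $G_1+[n-2]G_2$, where in $G_2$ the bigon is replaced by two arcs, one joining the two outer ends at $v$ and one joining the two outer ends at $w$, and in $G_1$ by the other two disjoint orientation-compatible arcs (each joining an outer end at $v$ to an outer end at $w$). (v) For three parallel, equally oriented strands, let $E_i$ ($i=1,2$) denote a vertex merging strands $i,i+1$; then $E_1E_2E_1+E_2=E_2E_1E_2+E_1$ (composition by stacking). (vi) Let the disk have six boundary points $p_1,\dots,p_6$ in cyclic order, alternately incoming and outgoing.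 Let $T$ be the triangle graph with directed-cycle triangular face whose three vertices carry outer ends $\{p_1,p_2\},\{p_3,p_4\},\{p_5,p_6\}$, and $T'$ the analogous one with $\{p_2,p_3\},\{p_4,p_5\},\{p_6,p_1\}$. Let $M$ be three disjoint arcs joining $p_1p_2,p_3p_4,p_5p_6$ and $M'$ three disjoint arcs joining $p_2p_3,p_4p_5,p_6p_1$. Then $T+[n-3]M'=T'+[n-3]M$. Bracket. For such $\Gamma$, $[\Gamma]=(q^{1-n})^{\mathrm{rot}(\Gamma)}R(\Gamma)$, where $\mathrm{rot}(\Gamma)$ is the sum over the disjoint oriented circles obtained by splicing each vertex according to orientation (into two non-crossing arcs, each from an incoming to an adjacent outgoing end) of $+1$ for each counterclockwise and $-1$ for each clockwise circle. For a balanced oriented graph with alternating vertices, $[\,\cdot\,]$ is extended by expanding each alternating vertex as $q$ times the smoothing in which each incoming strand turns left, plus $q^{-1}$ times the smoothing in which each incoming strand turns right. Evaluation of unoriented graphs. For an unoriented planar $4$-valent graph $\Gamma$, $\langle\!\langle\Gamma\rangle\!\rangle=\sum_{o}[\Gamma^{o}]$, the sum over all balanced orientations $o$ of $\Gamma$. *)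

(* Defs.v *)
(* Mathematical Components *)
From HB Require Import structures.
From mathcomp Require Import all_boot all_order all_algebra.

Set Implicit Arguments.
Unset Strict Implicit.
Unset Printing Implicit Defensive.

Import GRing.Theory.

(******************************************************************************)
(* Plane 4-valent graphs are represented by generic diagrams: put in general  *)
(* position with respect to the height function, a graph is a word, read from *)
(* bottom to top, whose letters (i, g) stand for a horizontal layer made of   *)
(* an elementary piece g with exactly i vertical strands on its left.         *)
(*                                                                            *)
(* Every strand carries a label in L and dual : L -> L is reversal.           *)
(*    L = unit, dual = id    unoriented graphs                                *)
(*    L = bool, dual = negb  oriented graphs, true meaning upwards            *)
(******************************************************************************)

(* Cup x : a minimum, Cap x : a maximum; x is the label of the left end.      *)
(* Vert a b c d : a vertex, with ends a, b at the bottom left and bottom      *)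
(* right, and c, d at the top left and top right.                             *)
Inductive gen (L : Type) : Type :=
  | Cup of L
  | Cap of L
  | Vert of L & L & L & L.

Definition word (L : Type) : Type := seq (nat * gen L).

Definition bottom (L : Type) (dual : L -> L) (g : gen L) : seq L :=
  match g with
  | Cup _ => [::]
  | Cap x => [:: x; dual x]
  | Vert a b _ _ => [:: a; b]
  end.

Definition top (L : Type) (dual : L -> L) (g : gen L) : seq L :=
  match g with
  | Cup x => [:: x; dual x]
  | Cap _ => [::]
  | Vert _ _ c d => [:: c; d]
  end.

(* The labels above a layer, from the labels s below it; None if they do not  *)
(* match.                                                                     *)
Definition layer (L : eqType) (dual : L -> L) (s : seq L) (l : nat * gen L) :
    option (seq L) :=
  let: (i, g) := l in
  if (i <= size s) && prefix (bottom dual g) (drop i s)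
  then Some (take i s ++ top dual g ++ drop (i + size (bottom dual g)) s)
  else None.

Fixpoint run (L : eqType) (dual : L -> L) (s : seq L) (w : word L) :
    option (seq L) :=
  if w is l :: w' then
    if layer dual s l is Some s' then run dual s' w' else None
  else Some s.

Definition closed (L : eqType) (dual : L -> L) (w : word L) : bool :=
  run dual [::] w == Some [::].

Definition shift (L : Type) (k : nat) (w : word L) : word L :=
  [seq (k + l.1, l.2) | l <- w].

(* The part of a diagram outside a disk, the disk being a rectangle with      *)
(* `left` strands on its left; plug E X is the diagram with X in the disk.    *)
Record exterior (L : Type) : Type :=
  Exterior { below : word L; left : nat; above : word L }.

Definition plug (L : Type) (E : exterior L) (X : word L) : word L :=
  below E ++ shift (left E) X ++ above E.

(* The moves generating planar isotopy of generic diagrams: exchanging the    *)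
(* heights of two pieces that are side by side, straightening a zigzag, and   *)
(* turning a vertex by sliding it from one leg of a cup or cap to the other.  *)
Inductive move (L : Type) (dual : L -> L) : word L -> word L -> Prop :=
  | Exchange k g h :
      move dual [:: (0, g); (size (top dual g) + k, h)]
                [:: (size (bottom dual g) + k, h); (0, g)]
  | ZigzagL x : move dual [:: (1, Cup (dual x)); (0, Cap x)] [::]
  | ZigzagR x : move dual [:: (0, Cup x); (1, Cap (dual x))] [::]
  | SlideCup x a c d :
      move dual [:: (1, Cup x); (0, Vert a x c d)]
                [:: (0, Cup c); (1, Vert (dual c) a d (dual x))]
  | SlideCap x a b d :
      move dual [:: (1, Vert a b (dual x) d); (0, Cap x)]
                [:: (0, Vert x a d (dual b)); (1, Cap (dual b))].

Inductive isotopic (L : eqType) (dual : L -> L) : word L -> word L -> Prop :=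
  | IsoMove E X Y : move dual X Y ->
      closed dual (plug E X) -> closed dual (plug E Y) ->
      isotopic dual (plug E X) (plug E Y)
  | IsoRefl w : isotopic dual w w
  | IsoSym w1 w2 : isotopic dual w1 w2 -> isotopic dual w2 w1
  | IsoTrans w1 w2 w3 :
      isotopic dual w1 w2 -> isotopic dual w2 w3 -> isotopic dual w1 w3.

(* ---- Unoriented graphs --------------------------------------------------- *)

Definition graph : Type := word unit.

Notation cup i := (i%N, Cup tt).
Notation cap i := (i%N, Cap tt).
Notation vert i := (i%N, Vert tt tt tt tt).

(* G is a graph that is E outside a disk and X inside it.                     *)
Definition looks_like (E : exterior unit) (X G : graph) : Prop :=
  closed id (plug E X) /\ isotopic id (plug E X) G.

(* The contents of the disk. The six boundary points p1, ..., p6 are on the   *)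
(* top side of the rectangle, from left to right. A vertex between two        *)
(* neighbouring cups, [:: cup i; cup i.+2; vert i.+1], is a vertex with its   *)
(* four ends pointing upwards.                                                *)
Definition tangle_T : graph :=
  [:: cup 0; cup 1; cup 3; vert 0; vert 2; vert 4].
Definition tangle_T' : graph :=
  [:: cup 0; cup 2; vert 1; cup 2; vert 1; vert 3].
Definition tangle_M : graph := [:: cup 0; cup 2; cup 4].
Definition tangle_M' : graph := [:: cup 0; cup 1; cup 3].
Definition tangle_V12 : graph := [:: cup 0; cup 2; vert 1; cup 0].
Definition tangle_V23 : graph := [:: cup 0; cup 2; vert 1; cup 1].
Definition tangle_V34 : graph := [:: cup 0; cup 2; vert 1; cup 2].
Definition tangle_V45 : graph := [:: cup 0; cup 2; vert 1; cup 3].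
Definition tangle_V56 : graph := [:: cup 0; cup 2; vert 1; cup 4].
Definition tangle_V61 : graph := [:: cup 0; cup 1; cup 3; vert 2].

Fact tangles_have_six_ends :
  all (fun X => run id [::] X == Some (nseq 6 tt))
    [:: tangle_T; tangle_T'; tangle_M; tangle_M'; tangle_V12; tangle_V23;
        tangle_V34; tangle_V45; tangle_V56; tangle_V61].
Proof. by []. Qed.

(* ---- Oriented graphs ----------------------------------------------------- *)

Definition ograph : Type := word bool.

(* The four ends of a vertex in counterclockwise order, starting from the     *)
(* bottom left; true means incoming.                                          *)
Definition incoming (a b c d : bool) : seq bool := [:: a; b; ~~ d; ~~ c].

Definition balanced (g : gen bool) : bool :=
  if g is Vert a b c d then count id (incoming a b c d) == 2 else true.

Definition alternating (g : gen bool) : bool :=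
  if g is Vert a b c d then
    (incoming a b c d == [:: true; false; true; false]) ||
    (incoming a b c d == [:: false; true; false; true])
  else false.

Definition balanced_graph (o : ograph) : bool :=
  closed negb o && all (fun l => balanced l.2) o.

(* Balanced graphs all of whose vertices are crossing-type.                   *)
Definition crossing_graph (o : ograph) : bool :=
  balanced_graph o && all (fun l => ~~ alternating l.2) o.

Definition gen_orientations (g : gen unit) : seq (gen bool) :=
  let B := [:: true; false] in
  let BB := [seq (x, y) | x <- B, y <- B] in
  match g with
  | Cup _ => [seq Cup x | x <- B]
  | Cap _ => [seq Cap x | x <- B]
  | Vert _ _ _ _ => [seq Vert p.1 p.2 r.1 r.2 | p <- BB, r <- BB]
  end.

Fixpoint labellings (G : graph) : seq ograph :=
  if G is (i, g) :: G' then
    [seq (i, g') :: o | g' <- gen_orientations g, o <- labellings G']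
  else [:: [::]].

(* A labelling is an orientation of G when labels agree along each edge,      *)
(* i.e. when it is a closed word. The list has no repetition.                 *)
Definition balanced_orientations (G : graph) : seq ograph :=
  [seq o <- labellings G | balanced_graph o].

(* ---- Rotation number ----------------------------------------------------- *)

(* At a crossing-type vertex the bottom ends are both incoming, both outgoing *)
(* (the splicing is then two vertical strands) or one of each.                *)
Definition splice_gen (l : nat * gen bool) : ograph :=
  match l with
  | (i, Vert a b c d) => if a == b then [::] else [:: (i, Cap a); (i, Cup c)]
  | _ => [:: l]
  end.

Definition splice (o : ograph) : ograph := flatten (map splice_gen o).

(* Signed count of the circles of a word without vertices. The word is read   *)
(* upwards; ids names, for each strand of the current level, the arc below    *)
(* the level to which it belongs, and fresh is an unused name. A circle is    *)
(* completed exactly at its highest point, by a cap joining the two ends of   *)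
(* the same arc: it is clockwise when it is traversed there from left to      *)
(* right, i.e. when the left end of the cap goes up.                          *)
Fixpoint count_circles (fresh : nat) (ids : seq nat) (o : ograph) : int :=
  match o with
  | [::] => 0%R
  | (i, Cup _) :: o' =>
      count_circles fresh.+1 (take i ids ++ [:: fresh; fresh] ++ drop i ids) o'
  | (i, Cap b) :: o' =>
      let x := nth 0 ids i in
      let y := nth 0 ids i.+1 in
      let rest := take i ids ++ drop i.+2 ids in
      if x == y then
        ((if b then -1 else 1) + count_circles fresh rest o')%R
      else count_circles fresh [seq if z == y then x else z | z <- rest] o'
  | (_, Vert _ _ _ _) :: o' => count_circles fresh ids o'
  end.

Definition rot (o : ograph) : int := count_circles 0 [::] (splice o).

(* ---- Coefficients -------------------------------------------------------- *)

Local Open Scope ring_scope.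

(* Z[q, q^-1] is viewed inside the field of rational functions.               *)
Definition coef : fieldType := {fraction {poly int}}.

Definition q : coef := @FracField.tofrac {poly int} 'X.

Definition qint (m : int) : coef := (q ^ m - q ^ (- m)) / (q - q^-1).

Definition laurent (x : coef) : Prop :=
  exists (p : {poly int}) (k : nat), x = @FracField.tofrac _ p / q ^+ k.

(* ---- The MOY graph polynomial -------------------------------------------- *)

Definition local_relation (R : ograph -> coef) (lhs rhs : seq (coef * ograph)) :
    Prop :=
  forall E : exterior bool,
    all (fun t => crossing_graph (plug E t.2)) (lhs ++ rhs) ->
    \sum_(t <- lhs) t.1 * R (plug E t.2) =
    \sum_(t <- rhs) t.1 * R (plug E t.2).

(* All orientations allowed by a relation are isotopic to one of the two      *)
(* obtained from b = true and b = false.                                      *)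
Record MOY_polynomial (n : nat) (R : ograph -> coef) : Prop := {
  MOY_laurent : forall o, crossing_graph o -> laurent (R o);
  MOY_isotopy : forall o o',
    crossing_graph o -> isotopic negb o o' -> R o = R o';
  MOY_empty : R [::] = 1;
  MOY_circle : forall b, local_relation R
    [:: (1, [:: (0%N, Cup b); (0%N, Cap b)])]
    [:: (qint n, [::])];
  MOY_loop : forall b, local_relation R
    [:: (1, [:: (1%N, Cup b); (0%N, Vert b b b b); (1%N, Cap b)])]
    [:: (qint (n%:Z - 1), [::])];
  MOY_parallel_bigon : forall b, local_relation R
    [:: (1, [:: (0%N, Vert b b b b); (0%N, Vert b b b b)])]
    [:: (qint 2, [:: (0%N, Vert b b b b)])];
  MOY_antiparallel_bigon : forall b, local_relation R
    [:: (1, [:: (0%N, Vert (~~ b) b b (~~ b));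
                (0%N, Vert b (~~ b) (~~ b) b)])]
    [:: (1, [::]);
        (qint (n%:Z - 2), [:: (0%N, Cap (~~ b)); (0%N, Cup (~~ b))])];
  MOY_three_strands : forall b,
    let E1 := (0%N, Vert b b b b) in
    let E2 := (1%N, Vert b b b b) in
    local_relation R
      [:: (1, [:: E1; E2; E1]); (1, [:: E2])]
      [:: (1, [:: E2; E1; E2]); (1, [:: E1])];
  (* the six boundary points, on top, are oriented b, ~~ b, b, ~~ b, b, ~~ b *)
  MOY_triangle : forall b,
    let T := [:: (0%N, Cup (~~ b)); (1%N, Cup b); (3%N, Cup b);
                 (0%N, Vert (~~ b) b b (~~ b));
                 (2%N, Vert (~~ b) b b (~~ b));
                 (4%N, Vert (~~ b) b b (~~ b))] in
    let T' := [:: (0%N, Cup b); (2%N, Cup b); (1%N, Vert (~~ b) b b (~~ b));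
                  (2%N, Cup (~~ b));
                  (1%N, Vert b (~~ b) (~~ b) b);
                  (3%N, Vert b (~~ b) (~~ b) b)] in
    let M := [:: (0%N, Cup b); (2%N, Cup b); (4%N, Cup b)] in
    let M' := [:: (0%N, Cup b); (1%N, Cup (~~ b)); (3%N, Cup (~~ b))] in
    local_relation R
      [:: (1, T); (qint (n%:Z - 3), M')]
      [:: (1, T'); (qint (n%:Z - 3), M)]
}.

(* ---- Bracket and evaluation ---------------------------------------------- *)

(* An alternating vertex is Vert true false true false, where the strands     *)
(* coming in at the bottom left and top right turn left into the top left and *)
(* bottom right (two vertical strands), or Vert false true false true, where  *)
(* those coming in at the bottom right and top left turn left into the bottom *)
(* left and top right (a cap below a cup).                                    *)
Definition resolve_gen (l : nat * gen bool) : seq (coef * ograph) :=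
  match l with
  | (i, Vert a b c d) =>
      if alternating (Vert a b c d) then
        let vertical := [::] in
        let horizontal := [:: (i, Cap a); (i, Cup c)] in
        if a then [:: (q, vertical); (q^-1, horizontal)]
        else [:: (q, horizontal); (q^-1, vertical)]
      else [:: (1, [:: l])]
  | _ => [:: (1, [:: l])]
  end.

Fixpoint resolve (o : ograph) : seq (coef * ograph) :=
  if o is l :: o' then
    [seq (x.1 * y.1, x.2 ++ y.2) | x <- resolve_gen l, y <- resolve o']
  else [:: (1, [::])].

Definition crossing_bracket (n : nat) (R : ograph -> coef) (o : ograph) : coef :=
  (q ^ (1 - n%:Z)) ^ rot o * R o.

Definition bracket (n : nat) (R : ograph -> coef) (o : ograph) : coef :=
  \sum_(x <- resolve o) x.1 * crossing_bracket n R x.2.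

Definition evaluation (n : nat) (R : ograph -> coef) (G : graph) : coef :=
  \sum_(o <- balanced_orientations G) bracket n R o.

(* Main.v *)
Require Import Defs.
From HB Require Import structures.
From mathcomp Require Import all_boot all_order all_algebra.
From mathcomp Require Import zify ring.

Set Implicit Arguments.
Unset Strict Implicit.
Unset Printing Implicit Defensive.

Import Order.TTheory GRing.Theory Num.Theory.
Local Open Scope ring_scope.

(** The evaluation of a graph is a sum over its states, a state being a balanced
    orientation together with a smoothing of every alternating vertex: each
    state contributes a power of [q], times [q ^ (1 - n)] to the power of a
    rotation number, times the value of [R] on a graph with crossing-type
    vertices only. So the relation should be a matter of comparing states inside
    the disk, for each of the twenty ways of orienting the six boundary points
    in a balanced way.

    The rotation number is in the way of this, as the circles that it counts
    cross the boundary of the disk. But it is half of the sum of the signs of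
    all minima and maxima of the diagram ([rot_turning]). This is where planarity
    is used: two arcs below a level of the diagram are nested or side by side,
    so an arc makes one half turn, to the left or to the right, however it
    wanders. The contributions of the disk and of its exterior can then be
    separated, and it is enough to compare the states inside the disk through
    all [skein_functional]s, the functions of words that satisfy the local
    relations of [R] ([evaluation_local]).

    Inside the disk, 256 words occur. Isotopies and the relations that remove
    circles, loops and bigons bring them to a few words, with coefficients that
    are Laurent polynomials in [q] and [q ^ n] divided by a power of [q - q^-1].
    For twelve orientations of the boundary everything then cancels. For the six
    in which the incoming points are consecutive, the three-strand relation,
    turned around the disk, is what remains; for the two alternating ones, it is
    the relation between the two cyclically oriented triangles. The
    simplification is carried out by a rewriting procedure, [normalise], whose
    soundness makes a principle of it: an identity between evaluations of graphs
    that agree outside a disk follows from a computation inside the disk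
    ([evaluation_by_computation]).

    That the evaluation does not depend on the diagram chosen for a graph
    ([evaluation_isotopic]) comes from the same principle for zigzags and for
    vertices slid along cups and caps. The exchange of two pieces that are side
    by side is treated apart: any number of strands may run between them, but
    their states are independent. *)

(** * Words as partial maps between levels *)

Arguments layer : simpl never.

Section GenEq.
Variable L : eqType.

Definition gen_code (g : gen L) : nat * seq L :=
  match g with
  | Cup x => (0%N, [:: x])
  | Cap x => (1%N, [:: x])
  | Vert a b c d => (2%N, [:: a; b; c; d])
  end.

Definition gen_decode (c : nat * seq L) : option (gen L) :=
  match c with
  | (0%N, [:: x]) => Some (Cup x)
  | (1%N, [:: x]) => Some (Cap x)
  | (_, [:: a; b; c; d]) => Some (Vert a b c d)
  | _ => None
  end.

Lemma gen_codeK : pcancel gen_code gen_decode. Proof. by case. Qed.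

HB.instance Definition _ := Equality.copy (gen L) (pcan_type gen_codeK).

End GenEq.

Section Words.
Variables (L : eqType) (dual : L -> L).
Implicit Types (s t : seq L) (w u v : word L) (g h : gen L).

Lemma layerP s i g s' :
  reflect (exists pre post, [/\ size pre = i, s = pre ++ bottom dual g ++ post
                               & s' = pre ++ top dual g ++ post])
          (layer dual s (i, g) == Some s').
Proof.
rewrite /layer; apply: (iffP eqP).
  case: ifP => // /andP[le_i /prefixP[post def_s]] [<-].
  exists (take i s), post; rewrite size_takel //; split=> //.
    by rewrite -def_s cat_take_drop.
  by rewrite addnC -drop_drop def_s drop_size_cat.
case=> pre [post [<- -> ->]].
rewrite size_cat leq_addr drop_size_cat // prefix_prefix take_size_cat //.
by rewrite addnC -drop_drop drop_size_cat // drop_size_cat.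
Qed.

Lemma layerE pre post g :
  layer dual (pre ++ bottom dual g ++ post) (size pre, g)
    = Some (pre ++ top dual g ++ post).
Proof. by apply/eqP/layerP; exists pre, post. Qed.

Lemma run_cat s u v :
  run dual s (u ++ v) = if run dual s u is Some t then run dual t v else None.
Proof. by elim: u s => [|l u IH] s //=; case: (layer dual s l). Qed.

Lemma shift0 w : shift 0 w = w.
Proof. by rewrite /shift -[RHS]map_id; apply: eq_map => -[]. Qed.

Lemma shift_shift i j w : shift i (shift j w) = shift (i + j) w.
Proof. by rewrite /shift -map_comp; apply: eq_map => l /=; rewrite addnA. Qed.

Lemma shift_cat i u v : shift i (u ++ v) = shift i u ++ shift i v.
Proof. exact: map_cat. Qed.

Lemma run_frame s t w pre post :
  run dual s w = Some t ->
  run dual (pre ++ s ++ post) (shift (size pre) w) = Some (pre ++ t ++ post).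
Proof.
elim: w s => [|[i g] w IH] s /=; first by case=> ->.
case E: (layer dual s (i, g)) => [s'|] //= run_w; have {}IH := IH _ run_w.
have /eqP/layerP[p [r [<- def_s def_s']]] := E.
have -> : pre ++ s ++ post = (pre ++ p) ++ bottom dual g ++ (r ++ post).
  by rewrite def_s -!catA.
by rewrite -size_cat layerE -IH def_s' -!catA.
Qed.

(** Without the bound, a piece that does not fit in [s] could still be placed
    with the help of the strands of [post]. *)
Lemma layer_frame s i g pre post :
  (i + size (bottom dual g) <= size s)%N ->
  layer dual (pre ++ s ++ post) (size pre + i, g)%N
    = omap (fun t => pre ++ t ++ post) (layer dual s (i, g)).
Proof.
move=> le_ig.
have le_i : (i <= size s)%N by apply: leq_trans le_ig; rewrite leq_addr.
have le_b : (size (bottom dual g) <= size (drop i s))%N by rewrite size_drop; lia.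
rewrite /layer le_i !size_cat leq_add2l (leq_trans le_i) ?leq_addr //=.
have dropE k : (k <= size s)%N ->
    drop (size pre + k) (pre ++ s ++ post) = drop k s ++ post.
  move=> le_k; rewrite addnC -drop_drop drop_size_cat // drop_cat.
  case: ltnP => // ge_k; have -> : k = size s by lia.
  by rewrite drop_size subnn drop0.
rewrite -addnA !dropE // !prefixE takel_cat //; case: ifP => //= _.
by rewrite takeD take_size_cat // drop_size_cat // takel_cat // -!catA.
Qed.

End Words.

(** * Rotation number *)

(** Counted counterclockwise. Going up at the left end means turning clockwise,
    both at a minimum and at a maximum. *)
Definition half_turn (b : bool) : int := if b then -1 else 1.

Definition gen_turning (g : gen bool) : int :=
  match g with Cup b | Cap b => half_turn b | Vert _ _ _ _ => 0 end.

Definition turning (o : ograph) : int :=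
  foldr (fun l k => gen_turning l.2 + k) 0 o.

Lemma turning_cat u v : turning (u ++ v) = turning u + turning v.
Proof. by elim: u => [|l u /= ->]; rewrite ?add0r ?addrA. Qed.

Lemma turning_shift k u : turning (shift k u) = turning u.
Proof. by elim: u => //= l u ->. Qed.

(** The possible states of [count_circles]: each strand of a level is given with
    the name of the arc below the level to which it belongs, and [a] is the sum
    of the half turns made by these arcs. Building the level by inserting the
    two ends of an arc side by side says that the arcs do not cross, and lends
    itself to induction better than a condition on the positions of the ends. *)
Inductive arcs : seq (nat * bool) -> int -> Prop :=
  | ArcsNil : arcs [::] 0
  | ArcsCup p r x b a : x \notin unzip1 (p ++ r) -> arcs (p ++ r) a ->
      arcs (p ++ [:: (x, b); (x, ~~ b)] ++ r) (a + half_turn b).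

Lemma two_pairs (T : Type) (p p' r r' : seq T) (u v u' v' : T) :
  p ++ [:: u; v] ++ r = p' ++ [:: u'; v'] ++ r' ->
  [\/ [/\ p = p', u = u', v = v' & r = r'],
      [/\ p' = rcons p u, u' = v & r = v' :: r'],
      [/\ p = rcons p' u', u = v' & r' = v :: r]
    | (exists m, p' = p ++ [:: u; v] ++ m /\ r = m ++ [:: u'; v'] ++ r')
      \/ (exists m, p = p' ++ [:: u'; v'] ++ m /\ r' = m ++ [:: u; v] ++ r)].
Proof.
elim: p p' => [|z p IH] [|z' p'] /=.
- by case=> -> -> ->; constructor 1.
- case=> <- {z'}; case: p' => [|z' p'] /= [<- ->]; first by constructor 2.
  by constructor 4; left; exists p'.
- case=> -> {z}; case: p {IH} => [|z p] /= [-> <-]; first by constructor 3.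
  by constructor 4; right; exists p.
case=> <- /IH[[-> -> -> ->]|[-> -> ->]|[-> -> ->]|[[m [-> ->]]|[m [-> ->]]]].
- by constructor 1.
- by constructor 2.
- by constructor 3.
- by constructor 4; left; exists m.
- by constructor 4; right; exists m.
Qed.

Definition rename (x y : nat) (s : seq (nat * bool)) : seq (nat * bool) :=
  [seq (if e.1 == y then x else e.1, e.2) | e <- s].

Lemma rename_cat x y s t : rename x y (s ++ t) = rename x y s ++ rename x y t.
Proof. exact: map_cat. Qed.

Lemma rename_id x y s : y \notin unzip1 s -> rename x y s = s.
Proof.
elim: s => //= -[z b] s IH; rewrite inE negb_or /= => /andP[ne_yz /IH ->].
by rewrite eq_sym (negPf ne_yz).
Qed.

Lemma unzip1_rename x y s :
  unzip1 (rename x y s) = [seq if z == y then x else z | z <- unzip1 s].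
Proof. by rewrite /unzip1 -!map_comp. Qed.

Lemma rename_notin x y z s :
  z \notin unzip1 s -> z != x -> z \notin unzip1 (rename x y s).
Proof.
move=> z_s ne_zx; rewrite unzip1_rename; apply: contra z_s => /mapP[w w_s].
by case: eqP => [_ eq_zx|_ ->] //; rewrite eq_zx eqxx in ne_zx.
Qed.

Lemma arcs_rename x y s a :
  x \notin unzip1 s -> arcs s a -> arcs (rename x y s) a.
Proof.
move=> x_s arcs_s; elim: arcs_s x_s => [|p r z b a' z_pr _ IH] x_s.
  exact: ArcsNil.
rewrite !rename_cat /=; apply: ArcsCup; last first.
  rewrite -rename_cat; apply: IH; apply: contra x_s.
  by rewrite /unzip1 !map_cat !mem_cat => /orP[] ->; rewrite ?orbT.
have ne_xz : x != z.
  apply: contra x_s => /eqP ->.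
  by rewrite /unzip1 !map_cat !mem_cat /= inE eqxx orbT.
rewrite -rename_cat unzip1_rename; apply/negP=> /mapP[w w_s].
case: (z =P y) => [eq_zy|ne_zy]; case: (w =P y) => [eq_wy|ne_wy] eq_w.
- by rewrite eq_zy -eq_wy w_s in z_pr.
- by rewrite -eq_w in w_s; case/negP: x_s; rewrite /unzip1 !map_cat !mem_cat
    in w_s *; case/orP: w_s => ->; rewrite ?orbT.
- by rewrite eq_w eqxx in ne_xz.
- by rewrite eq_w w_s in z_pr.
Qed.

(** Capping off two neighbouring strands closes an arc or merges two arcs. The
    arc that was inserted last is either disjoint from the cap, or closed by
    it, or joined at one end to another arc, which it merely lengthens. *)
Lemma arcs_cap p r x y b a :
  arcs (p ++ [:: (x, b); (y, ~~ b)] ++ r) a ->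
  if x == y then arcs (p ++ r) (a - half_turn b)
  else arcs (rename x y (p ++ r)) (a + half_turn b).
Proof.
have [s def_s] : exists s, s = p ++ [:: (x, b); (y, ~~ b)] ++ r by eexists.
rewrite -def_s => arcs_s.
elim: arcs_s p r def_s => {s a} [|p r z c a z_pr arcs_pr IH] p1 r1 def_s.
  by case: p1 def_s.
have half_turnN d : half_turn (~~ d) = - half_turn d by case: d.
(* The new arc, inserted beside a cap that avoids it. *)
have insert m1 m2 : p ++ r = m1 ++ [:: (x, b); (y, ~~ b)] ++ m2 ->
    forall n1 n2, m1 ++ m2 = n1 ++ n2 ->
    if x == y then arcs (n1 ++ [:: (z, c); (z, ~~ c)] ++ n2)
                        (a + half_turn c - half_turn b)
    else arcs (rename x y (n1 ++ [:: (z, c); (z, ~~ c)] ++ n2))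
              (a + half_turn c + half_turn b).
  move=> def_pr n1 n2 def_n; have := IH _ _ def_pr; rewrite !def_n.
  have := z_pr; rewrite def_pr /unzip1 map_cat mem_cat /= !inE !negb_or.
  case/and4P=> z_m1 ne_zx ne_zy z_m2.
  have z_n : z \notin unzip1 (n1 ++ n2).
    by rewrite -def_n /unzip1 map_cat mem_cat negb_or z_m1.
  case: ifP => _ arcs_n; first by rewrite addrAC; apply: ArcsCup.
  rewrite addrAC !rename_cat /= (negPf ne_zy); apply: ArcsCup.
    by rewrite -rename_cat rename_notin.
  by rewrite -rename_cat.
case: (two_pairs def_s) => [[<- [<- <-] [<-] <-]|[def_p1 [def_z def_c] def_r]
  |[def_p [def_z def_c] def_r1]|[[m [def_p1 def_r]]|[m [def_p def_r1]]]].
- by rewrite eqxx addrK.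
- subst p1 r z b; move: z_pr; rewrite /unzip1 map_cat mem_cat /= inE !negb_or.
  case/and3P=> x_p ne_xy x_r1; rewrite (negPf ne_xy) half_turnN addrK.
  have -> : rename x y (rcons p (x, c) ++ r1) = rename x y (p ++ (y, c) :: r1).
    by rewrite cat_rcons !rename_cat /= eqxx (negPf ne_xy).
  apply: arcs_rename; last by rewrite -[c]negbK.
  by rewrite /unzip1 map_cat mem_cat /= inE !negb_or x_p ne_xy.
- subst p r1 z c; move: z_pr; rewrite cat_rcons /unzip1 map_cat mem_cat /= inE.
  rewrite !negb_or eq_sym => /and3P[y_p1 ne_xy y_r]; rewrite (negPf ne_xy).
  rewrite half_turnN addrNK rename_cat /= eqxx negbK -cat_rcons.
  by rewrite !rename_id.
- have := insert (p ++ m) r1 _ p (m ++ r1); rewrite def_p1 -!catA; apply=> //.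
  by rewrite def_r.
have := insert p1 (m ++ r) _ (p1 ++ m) r; rewrite def_r1 -!catA; apply=> //.
by rewrite def_p -!catA.
Qed.

Lemma map_catE (T T' : Type) (f : T -> T') s p r :
  map f s = p ++ r -> exists p' r', [/\ s = p' ++ r', map f p' = p & map f r' = r].
Proof.
move=> def_s; exists (take (size p) s), (drop (size p) s).
by rewrite cat_take_drop map_take map_drop def_s take_size_cat // drop_size_cat.
Qed.

(** Planarity at work: the signed number of circles is half of the turning,
    since an arc between two ends of one level makes a single half turn. *)
Lemma count_circles_turning o fresh s a :
  arcs s a -> all (fun e => e.1 < fresh)%N s ->
  run negb (unzip2 s) o = Some [::] ->
  all (fun l => if l.2 is Vert _ _ _ _ then false else true) o ->
  count_circles fresh (unzip1 s) o *+ 2 = a + turning o.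
Proof.
elim: o fresh s a => [|[i g] o IH] fresh s a arcs_s s_lt /=.
  by case=> s0 _; case: arcs_s s0 => // -[].
case E: (layer _ _ _) => [t|] //; have /eqP/layerP[p [r [<-]]] := E.
case: g {E} => [b|b|] //= /map_catE[p' [r' [def_s <-]]].
  move=> <- -> run_o no_vert; subst s.
  rewrite /unzip1 map_cat size_map take_size_cat ?size_map //.
  rewrite drop_size_cat ?size_map //.
  have fresh_s : fresh \notin unzip1 (p' ++ r').
    by apply/mapP=> -[e /(allP s_lt) + eq_e]; rewrite -eq_e ltnn.
  have := IH fresh.+1 _ _ (ArcsCup b fresh_s arcs_s).
  rewrite /unzip2 /unzip1 !map_cat /= => -> //; first by rewrite addrA.
  move: s_lt; rewrite !all_cat /= !ltnSn /= => /andP[p_lt r_lt].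
  by apply/andP; split; [apply: sub_all p_lt | apply: sub_all r_lt] => e /ltnW.
case: r' def_s => [|[x b1] [|[y b2] r']] //= def_s [eq_b1 eq_b2 <-] -> run_o no_vert.
  subst s b1 b2.
  rewrite /unzip1 map_cat /= size_map.
  have nthE j : nth 0%N ([seq e.1 | e <- p'] ++ [:: x, y & [seq e.1 | e <- r']])
      (size p' + j) = nth 0%N [:: x, y & [seq e.1 | e <- r']] j.
    by rewrite nth_cat size_map ltnNge leq_addr addKn.
  rewrite -[in nth _ _ (size p')](addn0 (size p')) -[in nth _ _ _.+1]addn1 !nthE /=.
  rewrite take_size_cat ?size_map // -[(size p').+2]addn2 addnC -drop_drop.
  rewrite drop_size_cat ?size_map //= drop0 -map_cat -/(unzip1 _).
  have := arcs_cap arcs_s; move: s_lt; rewrite !all_cat /=.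
  case/and4P=> p_lt x_lt y_lt r_lt.
  rewrite /unzip2 -map_cat -/(unzip2 _) in run_o.
  case: ifP => _ arcs_pr.
    rewrite mulrnDl (IH _ _ _ arcs_pr _ run_o no_vert) ?all_cat ?p_lt //.
    by case: (b) => /=; ring.
  have run_o' : run negb (unzip2 (rename x y (p' ++ r'))) o = Some [::].
    by rewrite -run_o /unzip2 /rename -map_comp.
  rewrite -unzip1_rename (IH _ _ _ arcs_pr _ run_o' no_vert) ?addrA //.
  have: all (fun e => e.1 < fresh)%N (p' ++ r') by rewrite all_cat p_lt.
  by rewrite all_map; apply: sub_all => e /= lt_e; case: ifP.
Qed.

(** The letters allowed in a graph on which [R] is specified. *)
Definition good (l : nat * gen bool) : bool := balanced l.2 && ~~ alternating l.2.

Lemma crossing_graphE o :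
  crossing_graph o = (run negb [::] o == Some [::]) && all good o.
Proof.
rewrite /crossing_graph /balanced_graph /Defs.closed -andbA -all_predI.
by congr andb; apply: eq_all.
Qed.

(** The two turns made when a vertex is spliced sideways cancel. *)
Lemma turning_splice o : all good o -> turning (splice o) = turning o.
Proof.
elim: o => //= -[i g] o IH /andP[good_g good_o].
rewrite /splice /= turning_cat -/(splice o) IH //; congr (_ + _).
by case: g good_g => //= [b _|b _|]; rewrite ?addr0 //; do 4!case.
Qed.

Lemma run_splice s o : all good o -> run negb s o != None ->
  run negb s (splice o) = run negb s o.
Proof.
elim: o s => //= -[i g] o IH s /andP[good_g good_o].
case E: (layer _ _ _) => [t|] //= run_o; rewrite /splice /= run_cat -/(splice o).
suff -> : run negb s (splice_gen (i, g)) = Some t by rewrite IH.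
have /eqP/layerP[p [r [<- -> ->]]] := E.
case: g E good_g => /= [b|b|a b c d] _; rewrite ?(layerE _ p r (Cup b))
  ?(layerE _ p r (Cap b)) //.
case: eqP => [<-|ne_ab] good_v /=.
  by case: a c d good_v => -[] [].
have -> : b = ~~ a by case: a b ne_ab {good_v} => -[].
rewrite (layerE _ p r (Cap a)) /= (layerE _ p r (Cup c)) /=.
by case: a b c d ne_ab good_v => -[] [] [].
Qed.

Lemma no_vert_splice o :
  all (fun l => if l.2 is Vert _ _ _ _ then false else true) (splice o).
Proof.
by elim: o => //= -[i [b|b|a b c d]] o IH; rewrite /splice /= ?IH //; case: ifP.
Qed.

Lemma rot_turning o : crossing_graph o -> Defs.rot o *+ 2 = turning o.
Proof.
rewrite crossing_graphE => /andP[/eqP run_o good_o].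
rewrite -turning_splice // -[RHS]add0r.
apply: (@count_circles_turning _ 0%N [::] 0 ArcsNil) => //; last exact: no_vert_splice.
by rewrite [unzip2 _]/= run_splice ?run_o.
Qed.
(** * Evaluation as a sum over states *)

Lemma q_neq0 : q != 0.
Proof. by rewrite tofrac_eq0 polyX_eq0. Qed.

Definition resolutions (i : nat) (h : gen bool) : seq (int * ograph) :=
  match h with
  | Vert a b c d =>
      if alternating h then
        let turned := [:: (i, Cap a); (i, Cup c)] in
        if a then [:: (1, [::]); (-1, turned)] else [:: (1, turned); (-1, [::])]
      else [:: (0, [:: (i, h)])]
  | _ => [:: (0, [:: (i, h)])]
  end.

Lemma resolve_genE i h :
  resolve_gen (i, h) = [seq (q ^ r.1, r.2) | r <- resolutions i h].
Proof.
case: h => // a b c d; rewrite /resolve_gen /resolutions.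
by case: (alternating _) => //; case: a.
Qed.

Lemma resolutions_shift k i h :
  resolutions (k + i) h = [seq (r.1, shift k r.2) | r <- resolutions i h].
Proof.
case: h => // a b c d; rewrite /resolve_gen /resolutions.
by case: (alternating _) => //; case: a.
Qed.

(** A state is recorded by the labels of the top ends, the exponent of [q] and
    the word that is left after smoothing the alternating vertices. A vertex
    smoothed into two vertical strands leaves no trace in this word, so that the
    labels have to be checked level by level, before smoothing. *)
Fixpoint states (s : seq bool) (G : graph) : seq (seq bool * (int * ograph)) :=
  if G is (i, g) :: G' then
    flatten [seq if balanced h then
                   if layer negb s (i, h) is Some t then
                     [seq (x.1, (r.1 + x.2.1, r.2 ++ x.2.2))
                        | r <- resolutions i h, x <- states t G']
                   else [::]
                 else [::] | h <- gen_orientations g]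
  else [:: (s, (0, [::]))].

Section StateSums.
Variable V : nmodType.
Implicit Type F : seq bool * (int * ograph) -> V.

Lemma big_states_nil s F : \sum_(x <- states s [::]) F x = F (s, (0, [::])).
Proof. exact: big_seq1. Qed.

Lemma big_states_cons s i g G F :
  \sum_(x <- states s ((i, g) :: G)) F x =
  \sum_(h <- gen_orientations g | balanced h)
     if layer negb s (i, h) is Some t then
       \sum_(r <- resolutions i h) \sum_(x <- states t G)
          F (x.1, (r.1 + x.2.1, r.2 ++ x.2.2))
     else 0.
Proof.
rewrite /= big_flatten big_map [RHS]big_mkcond; apply: eq_bigr => h _.
case: ifP => _; last by rewrite big_nil.
case: (layer _ _ _) => [t|]; last by rewrite big_nil.
by rewrite big_allpairs_dep.
Qed.

Lemma big_states_cat s G1 G2 F :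
  \sum_(x <- states s (G1 ++ G2)) F x =
  \sum_(x <- states s G1) \sum_(y <- states x.1 G2)
     F (y.1, (x.2.1 + y.2.1, x.2.2 ++ y.2.2)).
Proof.
elim: G1 s F => [|[i g] G1 IH] s F.
  by rewrite big_states_nil; apply: eq_bigr => -[t [e w]]; rewrite add0r.
rewrite cat_cons !big_states_cons; apply: eq_bigr => h _.
case: (layer _ _ _) => // t; apply: eq_bigr => r _; rewrite IH.
apply: eq_bigr => x _; apply: eq_bigr => y _ /=.
by rewrite !addrA !catA.
Qed.

End StateSums.

Lemma states_sum s t G (K : ograph -> coef) :
  \sum_(o <- labellings G | (run negb s o == Some t) && all (fun l => balanced l.2) o)
     \sum_(x <- resolve o) x.1 * K x.2
  = \sum_(x <- states s G | x.1 == t) q ^ x.2.1 * K x.2.2.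
Proof.
elim: G s K => [|[i g] G IH] s K.
  rewrite big_mkcond [RHS]big_mkcond !big_seq1 /= andbT.
  rewrite -[Some s == Some t]/(s == t).
  by case: eqP => // _; rewrite big_seq1 expr0z.
rewrite [RHS]big_mkcond big_states_cons /= big_mkcond big_allpairs_dep /=.
rewrite [RHS]big_mkcond; apply: eq_bigr => h _.
case: (boolP (balanced h)) => [bal_h|_]; last first.
  by rewrite big1 // => o _; rewrite andFb andbF.
case: (layer _ _ _) => [s'|]; last by rewrite big1.
have -> : \sum_(r <- resolutions i h) \sum_(x <- states s' G)
    (if x.1 == t then q ^ (r.1 + x.2.1) * K (r.2 ++ x.2.2) else 0)
  = \sum_(r <- resolutions i h) \sum_(o <- labellings G |
      (run negb s' o == Some t) && all (fun l => balanced l.2) o)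
      \sum_(x <- resolve o) x.1 * (q ^ r.1 * K (r.2 ++ x.2)).
  apply: eq_bigr => r _; rewrite (IH s' (fun w => q ^ r.1 * K (r.2 ++ w))).
  rewrite [RHS]big_mkcond; apply: eq_bigr => x _.
  by case: ifP => // _; rewrite expfzDr ?q_neq0 // mulrCA mulrA.
rewrite exchange_big /= [RHS]big_mkcond; apply: eq_bigr => o _.
case: ifP => // _; rewrite -/(resolve_gen (i, h)) resolve_genE.
rewrite big_allpairs_dep big_map; apply: eq_bigr => r _ /=.
by apply: eq_bigr => x _; rewrite mulrCA mulrA.
Qed.

Lemma evaluation_states n R G :
  evaluation n R G =
  \sum_(x <- states [::] G | x.1 == [::]) q ^ x.2.1 * crossing_bracket n R x.2.2.
Proof. by rewrite -states_sum /evaluation /balanced_orientations big_filter. Qed.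
(** * Types of words *)

Definition typed (s t : seq bool) (w : ograph) : bool :=
  (run negb s w == Some t) && all good w.

Lemma typed_cat s t u w v :
  typed s t u -> typed t w v -> typed s w (u ++ v).
Proof.
case/andP=> /eqP run_u good_u /andP[/eqP run_v good_v].
by rewrite /typed run_cat run_u run_v all_cat good_u good_v eqxx.
Qed.

Lemma good_shift k w : all good (shift k w) = all good w.
Proof. by rewrite all_map. Qed.

Lemma typed_frame s t w pre post :
  typed s t w -> typed (pre ++ s ++ post) (pre ++ t ++ post) (shift (size pre) w).
Proof.
case/andP=> /eqP run_w good_w.
by rewrite /typed (run_frame _ _ run_w) good_shift good_w eqxx.
Qed.

Lemma typed_crossing w : typed [::] [::] w = crossing_graph w.
Proof. by rewrite crossing_graphE. Qed.

(** Smoothing a vertex keeps the labels: the bottom and top ends of an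
    alternating vertex are labelled alike, so that the vertex may be replaced by
    two vertical strands. *)
Lemma resolutions_typed s t i h r :
  layer negb s (i, h) = Some t -> balanced h -> r \in resolutions i h ->
  typed s t r.2.
Proof.
move=> layer_h bal_h; have /eqP/layerP[p [v [<- -> ->]]] := layer_h.
have [alt_h|alt_h] := boolP (alternating h); last first.
  suff -> : resolutions (size p) h = [:: (0, [:: (size p, h)])].
    by rewrite inE => /eqP ->; rewrite /typed /= layerE eqxx /= /good bal_h alt_h.
  by case: h alt_h {layer_h bal_h} => // a b c d; rewrite /resolutions => /negPf ->.
case: h alt_h {layer_h} bal_h => // a b c d alt_h bal_h.
rewrite /resolutions alt_h => in_r.
have run_cup : run negb (p ++ v) [:: (size p, Cup c)] = Some (p ++ [:: c; ~~ c] ++ v).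
  by rewrite /= (layerE _ p v (Cup c)).
have run_cap : layer negb (p ++ [:: a; ~~ a] ++ v) (size p, Cap a) = Some (p ++ v).
  exact: (layerE _ p v (Cap a)).
move: run_cup run_cap; case: a b c d alt_h bal_h in_r => -[] [] [] //= _ _;
  rewrite !inE => /orP[] /eqP -> /=; rewrite /typed /= => run_cup run_cap;
  by rewrite ?run_cap /= ?run_cup ?eqxx.
Qed.

Lemma states_typed s G x : x \in states s G -> typed s x.1 x.2.2.
Proof.
elim: G s x => [|[i g] G IH] s x /=.
  by rewrite inE => /eqP ->; rewrite /typed /= eqxx.
case/flattenP=> _ /mapP[h _ ->]; case: ifP => // bal_h.
case E: (layer _ _ _) => [t|] // /allpairsP[[r y] [in_r /IH typed_y ->]] /=.
exact: typed_cat (resolutions_typed E bal_h in_r) typed_y.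
Qed.

Lemma size_bottom g h : h \in gen_orientations g ->
  size (bottom negb h) = size (bottom id g) /\ size (top negb h) = size (top id g).
Proof.
case: g => [x|x|a b c d] /=; rewrite ?inE.
- by case/orP=> /eqP ->.
- by case/orP=> /eqP ->.
by do 15!(case/orP; first by move/eqP->); move/eqP->.
Qed.

Lemma nseq_unit (s : seq unit) : s = nseq (size s) tt.
Proof. by elim: s => //= -[] s {1}->. Qed.

Lemma layer_unit (s t : seq unit) i g : layer id s (i, g) = Some t ->
  (i + size (bottom id g) <= size s)%N /\
  size t = (size s + size (top id g) - size (bottom id g))%N.
Proof.
move/eqP/layerP=> [p [r [<- -> ->]]]; rewrite !size_cat leq_add2l leq_addr.
by rewrite addnA addnAC [(_ + (size (bottom _ _) + _))%N]addnCA -[in RHS]addnA addKn.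
Qed.

Lemma layer_size (s t : seq bool) i h : layer negb s (i, h) = Some t ->
  size t = (size s + size (top negb h) - size (bottom negb h))%N.
Proof.
move/eqP/layerP=> [p [r [_ -> ->]]]; rewrite !size_cat.
by rewrite addnA addnAC [(_ + (size (bottom _ _) + _))%N]addnCA -[in RHS]addnA addKn.
Qed.

Lemma states_size s G t x :
  run id (nseq (size s) tt) G = Some t -> x \in states s G -> size x.1 = size t.
Proof.
elim: G s x => [|[i g] G IH] s x /=.
  by case=> <-; rewrite inE => /eqP -> /=; rewrite size_nseq.
case E: (layer _ _ _) => [t1|] // run_G.
case/flattenP=> _ /mapP[h in_h ->]; case: ifP => // bal_h.
case E': (layer _ _ _) => [t2|] // /allpairsP[[r y] [_ in_y ->]] /=.
apply: IH in_y; rewrite (layer_size E') -run_G [t1]nseq_unit; congr run.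
have [-> ->] := size_bottom in_h.
by have [_ ->] := layer_unit E; rewrite size_nseq.
Qed.

Lemma states_frame s G pre post :
  run id (nseq (size s) tt) G != None ->
  states (pre ++ s ++ post) (shift (size pre) G) =
  [seq (pre ++ x.1 ++ post, (x.2.1, shift (size pre) x.2.2)) | x <- states s G].
Proof.
elim: G s => [|[i g] G IH] s //=.
case E: (layer _ _ _) => [t1|] // run_G; rewrite map_flatten -map_comp.
congr flatten; apply/eq_in_map=> h in_h /=; case: ifP => // _.
have [sz_b sz_t] := size_bottom in_h; have [le_i sz_t1] := layer_unit E.
rewrite size_nseq in le_i sz_t1.
rewrite layer_frame; last by rewrite sz_b.
case E': (layer _ _ _) => [t2|] //=.
have {}IH := IH t2; rewrite IH; last first.
  by rewrite (layer_size E') sz_b sz_t -sz_t1 -nseq_unit.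
rewrite resolutions_shift map_allpairs allpairs_mapl allpairs_mapr /=.
by apply: eq_allpairs => r x; rewrite shift_cat.
Qed.

(** * Reduction to local computations *)

Lemma split_weight (F : fieldType) (z a r : F) (i j k t c : int) :
  z != 0 -> a != 0 ->
  z ^ (i + (j + k)) * (a ^ (t + c) * r) = z ^ i * (z ^ j * a ^ t * (z ^ k * a ^ c * r)).
Proof. by move=> z_neq0 a_neq0; rewrite !expfzDr //; ring. Qed.

Section Local.
Variables (n : nat) (R : ograph -> coef).

(** The typical example closes up a word by an oriented exterior and applies
    [R]. Sums of these are what the states of an exterior give, and this is why
    the notion is abstracted. Nothing is required of ill-typed words, nor of
    words with a vertex on which [R] is not specified. *)
Definition skein_functional (s : seq bool) (psi : ograph -> coef) : Prop :=
  forall i P Q t (lhs rhs : seq (coef * ograph)), local_relation R lhs rhs ->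
    all (fun x => typed s t (P ++ shift i x.2 ++ Q)) (lhs ++ rhs) ->
    \sum_(x <- lhs) x.1 * psi (P ++ shift i x.2 ++ Q) =
    \sum_(x <- rhs) x.1 * psi (P ++ shift i x.2 ++ Q).

Definition state_sum (s : seq bool) (psi : ograph -> coef) (G : graph) : coef :=
  \sum_(x <- states s G)
     q ^ x.2.1 * (q ^ (1 - n%:Z)) ^ (turning x.2.2 %/ 2)%Z * psi x.2.2.

(** The share of [u] and [v] in the rotation number of [u ++ w ++ v]. The total
    turning is even, so [k] has the parity of [turning w], and half of it has to
    be rounded up when half of [turning w] is rounded down. *)
Definition rot_outside (u v : ograph) : int :=
  let k := turning u + turning v in ((k + (k %% 2)%Z) %/ 2)%Z.

Lemma rot_local u w v : crossing_graph (u ++ w ++ v) ->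
  Defs.rot (u ++ w ++ v) = (turning w %/ 2)%Z + rot_outside u v.
Proof. by move/rot_turning; rewrite /rot_outside !turning_cat; lia. Qed.

(** The function of the word [w] in the disk to which a state [u] of the part
    below the disk leads, once the states of the part above are summed over. *)
Definition closing_functional (E : exterior unit) (u : ograph)
    (s pre post : seq bool) (w : ograph) : coef :=
  if run negb s w is Some t then
    \sum_(y <- states (pre ++ t ++ post) (above E) | y.1 == [::])
       q ^ y.2.1 * (q ^ (1 - n%:Z)) ^ rot_outside u y.2.2
       * R (u ++ shift (size pre) w ++ y.2.2)
  else 0.

Lemma closing_skein E u s pre post :
  typed [::] (pre ++ s ++ post) u ->
  skein_functional s (closing_functional E u s pre post).
Proof.
move=> typed_u i P Q t lhs rhs rel typed_all.
have psiE x : x \in lhs ++ rhs ->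
    closing_functional E u s pre post (P ++ shift i x.2 ++ Q) =
    \sum_(y <- states (pre ++ t ++ post) (above E) | y.1 == [::])
       q ^ y.2.1 * (q ^ (1 - n%:Z)) ^ rot_outside u y.2.2
       * R (plug (Exterior (u ++ shift (size pre) P) (size pre + i)
                   (shift (size pre) Q ++ y.2.2)) x.2).
  move/(allP typed_all); rewrite /closing_functional => /andP[/eqP -> _].
  by apply: eq_bigr => y _; rewrite /plug /= !shift_cat shift_shift -!catA.
rewrite big_seq [RHS]big_seq.
under eq_bigr => x in_x do rewrite psiE ?mem_cat ?in_x // mulr_sumr.
under [RHS]eq_bigr => x in_x do rewrite psiE ?mem_cat ?in_x ?orbT // mulr_sumr.
rewrite -!big_seq exchange_big [RHS]exchange_big /=.
rewrite big_seq_cond [RHS]big_seq_cond; apply: eq_bigr => y /andP[in_y /eqP y0].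
under eq_bigr do rewrite mulrCA; under [RHS]eq_bigr do rewrite mulrCA.
rewrite -!mulr_sumr; congr (_ * _); apply: rel.
apply: sub_all typed_all => x typed_x.
have -> : plug (Exterior (u ++ shift (size pre) P) (size pre + i)
    (shift (size pre) Q ++ y.2.2)) x.2
  = u ++ shift (size pre) (P ++ shift i x.2 ++ Q) ++ y.2.2.
  by rewrite /plug /= !shift_cat shift_shift -!catA.
rewrite -typed_crossing; apply: typed_cat typed_u _.
apply: typed_cat (typed_frame pre post typed_x) _.
by have := states_typed in_y; rewrite y0.
Qed.

(** The sum over the states of [plug E G] is a sum over the states [u] of the
    part below the disk, each of which turns the rest into a state sum inside
    the disk. *)
Lemma evaluation_local (E : exterior unit) m s0 (D : seq (coef * graph)) :
  run id [::] (below E) = Some s0 -> (left E + m <= size s0)%N ->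
  all (fun x => run id (nseq m tt) x.2 != None) D ->
  (forall s psi, size s = m -> skein_functional s psi ->
     \sum_(x <- D) x.1 * state_sum s psi x.2 = 0) ->
  \sum_(x <- D) x.1 * evaluation n R (plug E x.2) = 0.
Proof.
move=> run_E le_m fits_D local.
pose pre (u : seq bool * (int * ograph)) := take (left E) u.1.
pose s (u : seq bool * (int * ograph)) := take m (drop (left E) u.1).
pose post (u : seq bool * (int * ograph)) := drop m (drop (left E) u.1).
have size_u u : u \in states [::] (below E) ->
    [/\ size (pre u) = left E, size (s u) = m & u.1 = pre u ++ s u ++ post u].
  move/(states_size (s := [::]) run_E) => sz_u.
  rewrite /= in sz_u; rewrite /pre /s /post !cat_take_drop -sz_u in le_m *.
  split=> //; first by rewrite size_takel // (leq_trans _ le_m) ?leq_addr.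
  by rewrite size_takel // size_drop leq_subRL // (leq_trans _ le_m) ?leq_addr.
have evalE G : run id (nseq m tt) G != None -> evaluation n R (plug E G) =
    \sum_(u <- states [::] (below E)) q ^ u.2.1
      * state_sum (s u) (closing_functional E u.2.2 (s u) (pre u) (post u)) G.
  move=> fits_G; rewrite evaluation_states big_mkcond big_states_cat.
  rewrite big_seq [RHS]big_seq; apply: eq_bigr => u in_u.
  have [sz_pre sz_s def_u] := size_u u in_u.
  rewrite big_states_cat {1}def_u -sz_pre states_frame; last by rewrite sz_s.
  rewrite big_map /state_sum mulr_sumr big_seq [RHS]big_seq.
  apply: eq_bigr => x in_x /=; have typed_x := states_typed in_x.
  rewrite /closing_functional; have /andP[/eqP-> _] := typed_x.
  rewrite mulr_sumr [in RHS]big_mkcond mulr_sumr big_seq [RHS]big_seq.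
  apply: eq_bigr => y in_y /=; case: eqP => [y0|_]; last by rewrite !mulr0.
  have typed_y := states_typed in_y; rewrite y0 in typed_y.
  have := states_typed in_u; rewrite def_u => typed_u.
  have cross : crossing_graph (u.2.2 ++ shift (size (pre u)) x.2.2 ++ y.2.2).
    rewrite -typed_crossing; apply: typed_cat typed_u _.
    exact: typed_cat (typed_frame _ _ typed_x) typed_y.
  rewrite /crossing_bracket rot_local // turning_shift.
  by apply: split_weight; rewrite ?expfz_neq0 ?q_neq0.
rewrite big_seq.
under eq_bigr => x in_x.
  rewrite evalE ?mulr_sumr; last exact: (allP fits_D).
  over.
rewrite -big_seq exchange_big /= big1_seq // => u /andP[_ in_u].
under eq_bigr do rewrite mulrCA.
have [sz_pre sz_s def_u] := size_u u in_u.
rewrite -mulr_sumr local ?mulr0 //; apply: closing_skein.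
have := states_typed in_u; rewrite def_u; exact.
Qed.

End Local.
(** * Formal coefficients *)

(** Laurent polynomials in [q] and [q ^ n], as lists of a coefficient and two
    exponents. *)
Definition lpoly : Type := seq (int * (int * int)).

(** [(p, k)] stands for [p] over [(q - q^-1) ^+ k]. *)
Definition weight : Type := lpoly * nat.

Definition lmul (p1 p2 : lpoly) : lpoly :=
  [seq (x.1 * y.1, (x.2.1 + y.2.1, x.2.2 + y.2.2)) | x <- p1, y <- p2].

Definition lden : lpoly := [:: (1, (1, 0)); (-1, (-1, 0))].

(** The numerator over [(q - q^-1) ^+ 4]: at most four quantum integers are
    multiplied in the computations below. *)
Definition numerator (c : weight) : lpoly := iter (4 - c.2) (lmul lden) c.1.

Definition lzero (p : lpoly) : bool :=
  all (fun e => foldr (fun x k => (if x.2 == e then x.1 else 0) + k) 0 p == 0)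
      (undup (unzip2 p)).

Definition smul (c1 c2 : weight) : weight := (lmul c1.1 c2.1, (c1.2 + c2.2)%N).

Definition smonom (c e f : int) : weight := ([:: (c, (e, f))], 0%N).

(** The value is [qint (k * n + j)]; see [value_qint]. *)
Definition sqint (k j : int) : weight :=
  ([:: (1, (j, k)); (-1, (- j, - k))], 1%N).

Lemma sum_by_key (V : nmodType) (T K : eqType) (key : T -> K) (s : seq T)
    (F : T -> V) :
  \sum_(x <- s) F x
  = \sum_(k <- undup (map key s)) \sum_(x <- s | key x == k) F x.
Proof.
under [RHS]eq_bigr do rewrite big_mkcond.
rewrite exchange_big /=; apply: eq_big_seq => x in_x.
rewrite (bigD1_seq (key x)) ?undup_uniq ?mem_undup ?map_f //= eqxx.
by rewrite big1 ?addr0 // => k; rewrite eq_sym => /negPf ->.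
Qed.

Section WeightValue.
Variables (F : fieldType) (z a : F).
Hypotheses (z_neq0 : z != 0) (a_neq0 : a != 0).

Definition lval (p : lpoly) : F :=
  \sum_(x <- p) x.1%:~R * (z ^ x.2.1 * a ^ x.2.2).

Definition weight_val (c : weight) : F := lval c.1 / (z - z^-1) ^+ c.2.

Lemma lval_flatten (ps : seq lpoly) : lval (flatten ps) = \sum_(p <- ps) lval p.
Proof. exact: big_flatten. Qed.

Lemma lval_mul p1 p2 : lval (lmul p1 p2) = lval p1 * lval p2.
Proof.
rewrite /lval big_allpairs_dep big_distrl /=; apply: eq_bigr => x _.
rewrite big_distrr /=; apply: eq_bigr => y _.
by rewrite /= intrM !expfzDr //; ring.
Qed.

Lemma lzeroP p : lzero p -> lval p = 0.
Proof.
move/allP=> zero_p; rewrite /lval (sum_by_key snd) big1_seq // => e /andP[_ in_e].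
have {}zero_p := eqP (zero_p e in_e).
transitivity (\sum_(x <- p) (if x.2 == e then x.1 else 0)%:~R * (z ^ e.1 * a ^ e.2)).
  rewrite big_mkcond; apply: eq_bigr => x _.
  by case: eqP => [->|]; rewrite ?mul0r.
rewrite -big_distrl /= -rmorph_sum /=.
suff -> : \sum_(x <- p) (if x.2 == e then x.1 else 0) = 0 by rewrite mul0r.
rewrite -[RHS]zero_p; elim: p {zero_p in_e} => [|x p IH]; first by rewrite big_nil.
by rewrite big_cons IH.
Qed.

Lemma weight_val_mul c1 c2 :
  weight_val (smul c1 c2) = weight_val c1 * weight_val c2.
Proof. by rewrite /weight_val lval_mul exprD invfM mulrACA. Qed.

Lemma weight_val_monom c e f :
  weight_val (smonom c e f) = c%:~R * (z ^ e * a ^ f).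
Proof. by rewrite /weight_val /lval big_seq1 divr1. Qed.

Lemma weight_val_numerator c : z - z^-1 != 0 -> (c.2 <= 4)%N ->
  weight_val c * (z - z^-1) ^+ 4 = lval (numerator c).
Proof.
move=> den_neq0 le_c; rewrite /weight_val /numerator.
have -> : lval (iter (4 - c.2) (lmul lden) c.1)
    = (z - z^-1) ^+ (4 - c.2) * lval c.1.
  elim: (4 - c.2)%N => [|k IH]; first by rewrite mul1r.
  rewrite iterS lval_mul IH exprS mulrA; congr (_ * _ * _).
  by rewrite /lval /lden big_cons big_seq1 /= !expr0z !mulr1 mul1r mulN1r.
rewrite -[in LHS](subnK le_c) exprD [_ ^+ _ * _]mulrC mulrA.
by rewrite divfK ?expf_neq0 // mulrC.
Qed.

End WeightValue.
(** * A rewriting system for words *)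

Definition combo : Type := seq (weight * ograph).

Definition rule : Type := ograph * combo.

Definition sone : weight := smonom 1 0 0.
Definition sminus : weight := smonom (- 1) 0 0.

(** Zigzags, circles, loops and bigons. A loop is given in the two forms
    in which it is met when cups are slid away from vertices. *)
Definition reductions : seq rule :=
  flatten [seq
    [:: ([:: (1%N, Cup (~~ b)); (0%N, Cap b)], [:: (sone, [::])]);
        ([:: (0%N, Cup b); (1%N, Cap (~~ b))], [:: (sone, [::])]);
        ([:: (0%N, Cup b); (0%N, Cap b)], [:: (sqint 1 0, [::])]);
        ([:: (0%N, Cup b); (0%N, Vert b (~~ b) (~~ b) b)],
         [:: (sqint 1 (- 1), [:: (0%N, Cup (~~ b))])]);
        ([:: (0%N, Vert b (~~ b) (~~ b) b); (0%N, Cap (~~ b))],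
         [:: (sqint 1 (- 1), [:: (0%N, Cap b)])]);
        ([:: (0%N, Vert b b b b); (0%N, Vert b b b b)],
         [:: (sqint 0 2, [:: (0%N, Vert b b b b)])]);
        ([:: (0%N, Vert (~~ b) b b (~~ b)); (0%N, Vert b (~~ b) (~~ b) b)],
         [:: (sone, [::]);
             (sqint 1 (- 2), [:: (0%N, Cap (~~ b)); (0%N, Cup (~~ b))])])]
    | b <- [:: true; false]].

(** Slides are used in one direction only, so that rewriting does not go back
    and forth. *)
Definition slides : seq rule :=
  flatten [seq
    [:: ([:: (1%N, Cup p.2); (0%N, Vert p.1 p.2 r.1 r.2)],
         [:: (sone, [:: (0%N, Cup r.1); (1%N, Vert (~~ r.1) p.1 r.2 (~~ p.2))])]);
        ([:: (1%N, Vert p.1 p.2 (~~ r.1) r.2); (0%N, Cap r.1)],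
         [:: (sone, [:: (0%N, Vert r.1 p.1 r.2 (~~ p.2)); (1%N, Cap (~~ p.2))])])]
    | p <- [seq (x, y) | x <- [:: true; false], y <- [:: true; false]],
      r <- [seq (x, y) | x <- [:: true; false], y <- [:: true; false]]].

Fixpoint first_some (A B : Type) (f : A -> option B) (s : seq A) : option B :=
  if s is x :: s' then if f x is Some y then Some y else first_some f s' else None.

Definition apply_rule (w : ograph) (r : rule) : option combo :=
  match r.1, w with
  | (j, _) :: _, (i, _) :: _ =>
      if take (size r.1) w == shift (i - j) r.1 then
        Some [seq (x.1, shift (i - j) x.2 ++ drop (size r.1) w) | x <- r.2]
      else None
  | _, _ => None
  end.

Definition apply_first (rs : seq rule) (w : ograph) : option combo :=
  first_some (apply_rule w) rs.

Definition swap (w : ograph) : option ograph :=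
  if w is l :: m :: w' then
    let: ((i, g), (j, h)) := (l, m) in
    if (i + size (top negb g) <= j)%N then
      Some [:: ((j - size (top negb g) + size (bottom negb g))%N, h), (i, g) & w']
    else if (j + size (bottom negb h) <= i)%N then
      Some [:: (j, h), ((i - size (bottom negb h) + size (top negb h))%N, g) & w']
    else None
  else None.

Arguments swap : simpl never.

(** A cup and a cap, or two vertices, that should cancel are often separated by
    pieces on their left or right. So a rule is tried with the second letter
    replaced by anything above it that can be moved down to its place. *)
Fixpoint fronts (w : ograph) : seq ograph :=
  if w is l :: w' then w :: pmap (fun v => swap (l :: v)) (fronts w') else [::].

Definition under (l : nat * gen bool) (C : combo) : combo :=
  [seq (x.1, l :: x.2) | x <- C].

Fixpoint adjacent (f : ograph -> option combo) (w : ograph) : option combo :=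
  if f w is Some C then Some C
  else if w is l :: w' then omap (under l) (adjacent f w') else None.

Definition reduce_at (w : ograph) : option combo :=
  if w is l :: w' then
    first_some (fun v => apply_first reductions (l :: v)) (fronts w')
  else None.

Definition sort_at (w : ograph) : option combo :=
  if w is (i, g) :: (j, h) :: _ then
    if (j + size (bottom negb h) <= i)%N then
      omap (fun v => [:: (sone, v)]) (swap w)
    else None
  else None.

(** Only when nothing can be reduced is a vertex slid, and only when no vertex
    can be slid are the letters sorted, so that words that differ by the heights
    of their pieces become equal. *)
Definition rewrite_once (w : ograph) : option combo :=
  if adjacent reduce_at w is Some C then Some C
  else if adjacent (apply_first slides) w is Some C then Some C
  else adjacent sort_at w.

(** Neither termination nor confluence is claimed: a word that is not rewritten
    to the end is still equal to what it was rewritten to. The test on types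
    supplies the hypothesis under which [skein_functional]s respect a rule. *)
Fixpoint normal_form (fuel : nat) (s : seq bool) (w : ograph) : combo :=
  if fuel isn't fuel'.+1 then [:: (sone, w)] else
  if rewrite_once w isn't Some C then [:: (sone, w)] else
  if all (fun x => (run negb s x.2 == run negb s w) && all good x.2) C then
    [seq (smul x.1 y.1, y.2) | x <- C, y <- normal_form fuel' s x.2]
  else [:: (sone, w)].

(** No word below takes as many as 40 steps. *)
Definition normalise (s : seq bool) (C : combo) : combo :=
  [seq (smul x.1 y.1, y.2) | x <- C, y <- normal_form 40 s x.2].

Definition cancels (C : combo) : bool :=
  all (fun x => x.1.2 <= 4)%N C &&
  all (fun w => lzero (flatten [seq numerator x.1 | x <- C & x.2 == w]))
      (undup (unzip2 C)).

Definition state_combo (s : seq bool) (D : seq (weight * graph)) : combo :=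
  [seq (smul x.1 (smonom 1 (y.2.1 + (turning y.2.2 %/ 2)%Z)
                           (- (turning y.2.2 %/ 2)%Z)), y.2.2)
     | x <- D, y <- states s x.2].
(** * Soundness of the rewriting system *)

Section Soundness.
Variables (n : nat) (R : ograph -> coef).
Hypothesis R_MOY : MOY_polynomial n R.

Definition value (c : weight) : coef := weight_val q (q ^ n%:Z) c.

Definition values (C : combo) : seq (coef * ograph) :=
  [seq (value x.1, x.2) | x <- C].

Definition combo_val (psi : ograph -> coef) (C : combo) : coef :=
  \sum_(x <- C) value x.1 * psi x.2.

Lemma qn_neq0 : q ^ n%:Z != 0. Proof. by rewrite expfz_neq0 ?q_neq0. Qed.

Lemma value_mul c1 c2 : value (smul c1 c2) = value c1 * value c2.
Proof. exact: weight_val_mul q_neq0 qn_neq0 _ _. Qed.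

Lemma value_one : value sone = 1.
Proof. by rewrite /value weight_val_monom mulr1 mulr1. Qed.

Lemma value_minus : value sminus = - 1.
Proof. by rewrite /value weight_val_monom !mulr1. Qed.

Lemma value_qint (k j : int) : value (sqint k j) = qint (k * n%:Z + j).
Proof.
rewrite /value /weight_val /lval /sqint big_cons big_seq1 /= /qint.
rewrite expr1 mul1r mulN1r !exprz_exp -!expfzDr ?q_neq0 //.
by rewrite mulrN -opprD [j + _]addrC [_ * k]mulrC.
Qed.

Lemma skein_prefix s t psi u : skein_functional R s psi -> typed s t u ->
  skein_functional R t (fun w => psi (u ++ w)).
Proof.
move=> skein_psi typed_u i P Q t' lhs rhs rel typed_all.
under eq_bigr do rewrite catA; under [RHS]eq_bigr do rewrite catA.
apply: (skein_psi) rel _; apply: sub_all typed_all => x.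
by rewrite -catA; apply: typed_cat.
Qed.

Lemma move_relation X Y : move negb X Y -> local_relation R [:: (1, X)] [:: (1, Y)].
Proof.
move=> XY E /= /and3P[cross_X cross_Y _]; rewrite !big_seq1 /= !mul1r.
apply: (MOY_isotopy R_MOY cross_X); apply: (@IsoMove _ _ E X Y XY).
  by case/andP: cross_X => /andP[].
by case/andP: cross_Y => /andP[].
Qed.

Lemma skein_move s t psi i P Q X Y : skein_functional R s psi -> move negb X Y ->
    typed s t (P ++ shift i X ++ Q) -> typed s t (P ++ shift i Y ++ Q) ->
  psi (P ++ shift i X ++ Q) = psi (P ++ shift i Y ++ Q).
Proof.
move=> skein_psi /move_relation XY typed_X typed_Y.
have := skein_psi i P Q t _ _ XY; rewrite !big_seq1 /= !mul1r typed_X typed_Y.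
exact.
Qed.

(** Unlike [reduces_to], this includes that the type is preserved, as the words
    on the way between two exchanges are not tested. *)
Definition same (w v : ograph) : Prop :=
  forall s t psi, skein_functional R s psi -> typed s t w ->
    typed s t v /\ psi w = psi v.

Definition reduces_to (w : ograph) (C : combo) : Prop :=
  forall s t psi, skein_functional R s psi -> typed s t w ->
    all (fun x => typed s t x.2) C -> psi w = combo_val psi C.

Lemma typed_cons s t l w : typed s t (l :: w) ->
  exists2 s', typed s s' [:: l] & typed s' t w.
Proof.
rewrite /typed /=; case: (layer _ _ _) => //= s' /and3P[run_w good_l good_w].
by exists s'; rewrite ?eqxx ?andbT // run_w.
Qed.

Lemma same_cons l w v : same w v -> same (l :: w) (l :: v).
Proof.
move=> wv s t psi skein_psi /typed_cons[s' typed_l typed_w].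
have [typed_v eq_wv] := wv _ _ _ (skein_prefix skein_psi typed_l) typed_w.
by split; first exact: typed_cat typed_l typed_v.
Qed.

Lemma under_reduces l w C : reduces_to w C -> reduces_to (l :: w) (under l C).
Proof.
move=> wC s t psi skein_psi /typed_cons[s' typed_l typed_w].
rewrite all_map => typed_C.
rewrite (wC _ _ _ (skein_prefix skein_psi typed_l) typed_w).
  by rewrite /combo_val big_map.
apply: sub_all typed_C => x /= /typed_cons[s'' typed_l' typed_x].
suff -> : s' = s'' by [].
by move: typed_l typed_l' => /andP[/eqP run_l _] /andP[]; rewrite run_l => /eqP[].
Qed.

Lemma cat_split (T : Type) (a b c d : seq T) : a ++ b = c ++ d ->
  (size a <= size c)%N -> exists m, c = a ++ m /\ b = m ++ d.
Proof.
elim: a c => [|x a IH] [|y c] //=; first by move=> -> _; exists [::].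
  by move=> -> _; exists (y :: c).
by case=> -> /IH IH' /IH'[m [-> ->]]; exists m.
Qed.

Lemma run_exchange s t i k g h :
  run negb s [:: (i, g); ((i + size (top negb g) + k)%N, h)] = Some t <->
  run negb s [:: ((i + size (bottom negb g) + k)%N, h); (i, g)] = Some t.
Proof.
split=> /=.
  case E: (layer negb s (i, g)) => [s1|] //.
  have /eqP/layerP[p [r [sz_p -> def_s1]]] := E.
  case E1: (layer _ s1 _) => [s2|] // [<-].
  have /eqP/layerP[p' [r' [sz_p' def_s1' ->]]] := E1.
  have [] := @cat_split _ (p ++ top negb g) r p' (bottom negb h ++ r').
  - by rewrite -catA -def_s1 def_s1'.
  - by rewrite sz_p' size_cat sz_p leq_addr.
  move=> m [def_p' ->]; move: sz_p'; rewrite def_p' !size_cat sz_p => /addnI sz_m.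
  have -> : p ++ bottom negb g ++ m ++ bottom negb h ++ r'
    = (p ++ bottom negb g ++ m) ++ bottom negb h ++ r' by rewrite -!catA.
  have -> : (i + size (bottom negb g) + k)%N = size (p ++ bottom negb g ++ m).
    by rewrite !size_cat sz_p sz_m addnA.
  by rewrite layerE /= -!catA -sz_p layerE.
case E: (layer negb s _) => [s1|] //.
have /eqP/layerP[p' [r' [sz_p' -> def_s1]]] := E.
case E1: (layer _ s1 _) => [s2|] // [<-].
have /eqP/layerP[p [r [sz_p def_s1' ->]]] := E1.
have [] := @cat_split _ (p ++ bottom negb g) r p' (top negb h ++ r').
- by rewrite -catA -def_s1' def_s1.
- by rewrite sz_p' size_cat sz_p leq_addr.
move=> m [def_p' ->]; move: sz_p'; rewrite def_p' !size_cat sz_p => /addnI sz_m.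
rewrite -!catA -sz_p layerE /=.
have -> : p ++ top negb g ++ m ++ bottom negb h ++ r'
  = (p ++ top negb g ++ m) ++ bottom negb h ++ r' by rewrite -!catA.
have -> : (size p + size (top negb g) + k)%N = size (p ++ top negb g ++ m).
  by rewrite !size_cat sz_m addnA.
by rewrite layerE -!catA.
Qed.

Lemma typed_exchange s t i k g h w :
  typed s t [:: (i, g), ((i + size (top negb g) + k)%N, h) & w] =
  typed s t [:: ((i + size (bottom negb g) + k)%N, h), (i, g) & w].
Proof.
rewrite /typed -(cat1s (i, g)) -(cat1s (_, h)) catA run_cat -[in RHS]cat1s.
rewrite -[in RHS](cat1s (i, g)) [in RHS]catA [in RHS]run_cat.
congr andb; last by rewrite /= andbCA.
have exch := run_exchange s _ i k g h.
case E: (run negb s _) => [s'|]; first by rewrite (exch s').1.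
by case E': (run negb s _) => [s'|] //; rewrite (exch s').2 in E.
Qed.

Lemma same_exchange i k g h w :
  same [:: (i, g), ((i + size (top negb g) + k)%N, h) & w]
       [:: ((i + size (bottom negb g) + k)%N, h), (i, g) & w].
Proof.
move=> s t psi skein_psi typed_w; have typed_v := typed_w.
rewrite typed_exchange in typed_v; split=> //.
have := skein_move (P := [::]) (i := i) (Q := w) skein_psi (Exchange negb k g h).
by rewrite /= addn0 !addnA => /(_ t); apply.
Qed.

Lemma same_exchange_sym i k g h w :
  same [:: ((i + size (bottom negb g) + k)%N, h), (i, g) & w]
       [:: (i, g), ((i + size (top negb g) + k)%N, h) & w].
Proof.
move=> s t psi skein_psi; rewrite -typed_exchange => typed_w; split=> //.
by have [_ ->] := same_exchange skein_psi typed_w.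
Qed.

Lemma swap_same w v : swap w = Some v -> same w v.
Proof.
case: w => [|[i g] [|[j h] w]] //; rewrite /swap; case: leqP => [/subnKC def_j|_].
  case=> <-; have := @same_exchange i (j - (i + size (top negb g))) g h w.
  rewrite def_j; congr same; congr (_ :: _); congr pair.
  by move: def_j; lia.
case: leqP => [/subnKC def_i|_] //.
case=> <-; have := @same_exchange_sym j (i - (j + size (bottom negb h))) h g w.
rewrite def_i; congr same; congr [:: _, _ & _]; congr pair.
by move: def_i; lia.
Qed.

Lemma same_refl w : same w w. Proof. by move=> s t psi. Qed.

Lemma same_trans w v u : same w v -> same v u -> same w u.
Proof.
move=> wv vu s t psi skein_psi /(wv _ _ _ skein_psi)[typed_v ->].
exact: vu typed_v.
Qed.

Lemma fronts_same w v : v \in fronts w -> same w v.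
Proof.
elim: w v => //= l w IH v; rewrite inE => /predU1P[-> |]; first exact: same_refl.
rewrite mem_pmap => /mapP[u /IH wu /esym/swap_same]; apply: same_trans.
exact: same_cons.
Qed.

Lemma same_reduces w v C : same w v -> reduces_to v C -> reduces_to w C.
Proof.
move=> wv vC s t psi skein_psi /(wv _ _ _ skein_psi)[typed_v ->].
exact: vC typed_v.
Qed.

Definition sound (r : rule) : Prop := local_relation R [:: (1, r.1)] (values r.2).

Lemma apply_ruleP r w C : sound r -> apply_rule w r = Some C -> reduces_to w C.
Proof.
rewrite /apply_rule; case: r => u D /= sound_r.
case def_u: u => [|[j h] u'] //; case def_w: w => [|[i g] w'] //.
rewrite -def_u -def_w; case: eqP => // eq_w [<-] s t psi skein_psi typed_w typed_C.
have := skein_psi (i - j)%N [::] (drop (size u) w) t _ _ sound_r.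
rewrite big_seq1 /combo_val !big_map /= mul1r -eq_w cat_take_drop => -> //.
by rewrite typed_w /=; move: typed_C; rewrite !all_map.
Qed.

Lemma first_someP (A : eqType) (B : Type) (f : A -> option B) s y :
  first_some f s = Some y -> exists2 x, x \in s & f x = Some y.
Proof.
elim: s => //= x s IH; case E: (f x) => [z|].
  by case=> <-; exists x; rewrite ?mem_head.
by case/IH=> x' in_x' fx'; exists x'; rewrite // inE in_x' orbT.
Qed.

Lemma adjacentP f w C :
  (forall v D, f v = Some D -> reduces_to v D) ->
  adjacent f w = Some C -> reduces_to w C.
Proof.
move=> f_sound; elim: w C => [|l w IH] C /=.
  by case E: (f _) => [D|] // [<-]; apply: f_sound.
case E: (f _) => [D|]; first by case=> <-; apply: f_sound.
by case E': (adjacent f w) => [D|] // [<-]; apply/under_reduces/IH.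
Qed.

(** ** The rules are sound *)

Lemma crossing_plug E p r s t w w' : run negb [::] (below E) = Some (p ++ s ++ r) ->
  size p = left E -> typed s t w -> typed s t w' ->
  crossing_graph (plug E w) -> crossing_graph (plug E w').
Proof.
move=> run_E sz_p typed_w typed_w'; rewrite -!typed_crossing /plug -sz_p.
have /andP[/eqP run_w _] := typed_frame p r typed_w.
have /andP[/eqP run_w' good_w'] := typed_frame p r typed_w'.
case/andP; rewrite run_cat run_E /= run_cat run_w !all_cat => run_above.
case/and3P=> good_E _ good_above.
by rewrite /typed run_cat run_E /= run_cat run_w' !all_cat run_above good_E good_w'.
Qed.

(** A relation between words of one type need only be tested on functionals,
    provided that the word on the left can occur only where its type fits. *)
Lemma relation_of_functionals s t w (C : seq (coef * ograph)) :
    (forall E, crossing_graph (plug E w) -> exists p r,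
       run negb [::] (below E) = Some (p ++ s ++ r) /\ size p = left E) ->
    typed s t w -> all (fun x => typed s t x.2) C ->
    (forall psi, skein_functional R s psi -> psi w = \sum_(x <- C) x.1 * psi x.2) ->
  local_relation R [:: (1, w)] C.
Proof.
move=> fits typed_w typed_C test E /= /andP[cross_w cross_C].
rewrite big_seq1 /= mul1r; have [p [r [run_E sz_p]]] := fits E cross_w.
pose psi v := if run negb s v == Some t then R (plug E v) else 0.
have psiE v : typed s t v -> psi v = R (plug E v) by rewrite /psi => /andP[-> _].
rewrite -psiE // test; last first.
  move=> i P Q t' lhs rhs rel typed_all; have [eq_t|ne_t] := eqVneq t' t.
    have plugE x : plug E (P ++ shift i x ++ Q) =
        plug (Exterior (below E ++ shift (left E) P) (left E + i)
                       (shift (left E) Q ++ above E)) x.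
      by rewrite /plug /= !shift_cat shift_shift -!catA.
    rewrite big_seq [RHS]big_seq.
    under eq_bigr => x in_x.
      rewrite psiE ?plugE; last by rewrite -eq_t (allP typed_all) ?mem_cat ?in_x.
      over.
    under [RHS]eq_bigr => x in_x.
      rewrite psiE ?plugE; last by rewrite -eq_t (allP typed_all) ?mem_cat ?in_x ?orbT.
      over.
    rewrite -!big_seq; apply: rel; apply: sub_all typed_all => x; rewrite eq_t -plugE.
    by move=> typed_x; apply: (crossing_plug run_E sz_p typed_w typed_x cross_w).
  rewrite !big1_seq // => x /andP[_ in_x];
    have /(allP typed_all)/andP[/eqP run_x _] : x \in lhs ++ rhs
      by rewrite mem_cat in_x ?orbT.
  - by rewrite /psi run_x (inj_eq Some_inj) (negPf ne_t) mulr0.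
  by rewrite /psi run_x (inj_eq Some_inj) (negPf ne_t) mulr0.
rewrite big_seq [RHS]big_seq; apply: eq_bigr => x in_x.
by rewrite psiE // (allP typed_C).
Qed.

(** Make a zigzag in the top left end of the vertex. When its cup is pulled below
    the vertex and the vertex is slid across its cap, the loop gets the form that
    it has in the definition of [R]. *)
Lemma loop_below b :
  sound ([:: (0%N, Cup b); (0%N, Vert b (~~ b) (~~ b) b)],
         [:: (sqint 1 (- 1), [:: (0%N, Cup (~~ b))])]).
Proof.
apply: (@relation_of_functionals [::] [:: ~~ b; b]) => [E|||psi skein_psi].
- rewrite -typed_crossing /typed /plug run_cat => /andP[+ _].
  case run_E: (run _ _ _) => [s|] //=; rewrite addn0.
  case E1: (layer _ _ _) => [s'|] // _.
  have /eqP/layerP[p [r [sz_p def_s _]]] := E1.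
  by exists p, r; rewrite def_s.
- by case: b.
- by case: b.
have moves P i Q X Y m := @skein_move [::] [:: ~~ b; b] psi i P Q X Y skein_psi m.
have loop := skein_psi 1%N [:: (0%N, Cup (~~ b))] [::] [:: ~~ b; b] _ _
  (@MOY_loop _ _ R_MOY b).
rewrite !big_seq1 /= !mul1r value_qint mul1r in loop *.
rewrite -loop => {loop}; last by case: (b).
set v := Vert b (~~ b) (~~ b) b; set c := (0%N, Cup (~~ b)).
have add_zigzag : psi [:: (0%N, Cup b); (0%N, v)]
    = psi [:: (0%N, Cup b); (0%N, v); c; (1%N, Cap b)].
  rewrite /c /v; case: (b) moves => moves; symmetry.
    exact: (moves [:: (0%N, Cup true); (0%N, Vert true false false true)] 0%N [::]
             _ _ (ZigzagR negb false)).
  exact: (moves [:: (0%N, Cup false); (0%N, Vert false true true false)] 0%N [::]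
             _ _ (ZigzagR negb true)).
rewrite add_zigzag.
have lift_vertex : psi [:: (0%N, Cup b); c; (2%N, v); (1%N, Cap b)]
    = psi [:: (0%N, Cup b); (0%N, v); c; (1%N, Cap b)].
  by apply: (moves [:: (0%N, Cup b)] 0%N [:: (1%N, Cap b)] _ _
    (Exchange negb 0 (Cup (~~ b)) v)); rewrite /v /c; case: (b).
rewrite -lift_vertex.
have lift_cup : psi [:: c; (2%N, Cup b); (2%N, v); (1%N, Cap b)]
    = psi [:: (0%N, Cup b); c; (2%N, v); (1%N, Cap b)].
  by apply: (moves [::] 0%N [:: (2%N, v); (1%N, Cap b)] _ _
    (Exchange negb 0 (Cup (~~ b)) (Cup b))); rewrite /v /c; case: (b).
rewrite -lift_cup.
rewrite /v /c; case: (b) moves => moves.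
  by apply: (moves [:: (0%N, Cup false); (2%N, Cup true)] 1%N [::] _ _
    (SlideCap negb true true false true)).
by apply: (moves [:: (0%N, Cup true); (2%N, Cup false)] 1%N [::] _ _
    (SlideCap negb false false true false)).
Qed.

(** As for [loop_below], with a zigzag in the bottom left end: its cap is pulled
    above the vertex, which is then slid across its cup. *)
Lemma loop_above b :
  sound ([:: (0%N, Vert b (~~ b) (~~ b) b); (0%N, Cap (~~ b))],
         [:: (sqint 1 (- 1), [:: (0%N, Cap b)])]).
Proof.
apply: (@relation_of_functionals [:: b; ~~ b] [::]) => [E|||psi skein_psi].
- rewrite -typed_crossing /typed /plug run_cat => /andP[+ _].
  case run_E: (run _ _ _) => [s|] //=; rewrite addn0.
  case E1: (layer _ _ _) => [s'|] // _.
  have /eqP/layerP[p [r [sz_p def_s _]]] := E1.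
  by exists p, r; rewrite def_s.
- by case: b.
- by case: b.
have moves P i Q X Y m := @skein_move [:: b; ~~ b] [::] psi i P Q X Y skein_psi m.
have loop := skein_psi 1%N [::] [:: (0%N, Cap b)] [::] _ _
  (@MOY_loop _ _ R_MOY (~~ b)).
rewrite !big_seq1 /= !mul1r value_qint mul1r in loop *.
rewrite -loop => {loop}; last by case: (b).
set v := Vert b (~~ b) (~~ b) b; set c := (0%N, Cap (~~ b)).
have add_zigzag : psi [:: (1%N, Cup (~~ b)); (0%N, Cap b); (0%N, v); c]
    = psi [:: (0%N, v); c].
  by apply: (moves [::] 0%N [:: (0%N, v); c] _ _ (ZigzagL negb b));
    rewrite /v /c; case: (b).
rewrite -add_zigzag.
have lower_vertex : psi [:: (1%N, Cup (~~ b)); (0%N, Cap b); (0%N, v); c]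
    = psi [:: (1%N, Cup (~~ b)); (2%N, v); (0%N, Cap b); c].
  by apply: (moves [:: (1%N, Cup (~~ b))] 0%N [:: c] _ _
    (Exchange negb 0 (Cap b) v)); rewrite /v /c; case: (b).
rewrite lower_vertex.
have lower_cap : psi [:: (1%N, Cup (~~ b)); (2%N, v); (0%N, Cap b); c]
    = psi [:: (1%N, Cup (~~ b)); (2%N, v); (2%N, Cap (~~ b)); (0%N, Cap b)].
  by apply: (moves [:: (1%N, Cup (~~ b)); (2%N, v)] 0%N [::] _ _
    (Exchange negb 0 (Cap b) (Cap (~~ b)))); rewrite /v /c; case: (b).
rewrite lower_cap; symmetry; rewrite /v /c; case: (b) moves => moves.
  exact: (moves [::] 1%N [:: (2%N, Cap false); (0%N, Cap true)] _ _
    (SlideCup negb false false false false) isT isT).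
exact: (moves [::] 1%N [:: (2%N, Cap true); (0%N, Cap false)] _ _
    (SlideCup negb true true true true) isT isT).
Qed.

Lemma move_sound X Y : move negb X Y -> sound (X, [:: (sone, Y)]).
Proof. by move=> XY; rewrite /sound /= value_one; apply: move_relation. Qed.

Lemma reductions_sound r : r \in reductions -> sound r.
Proof.
case/flattenP=> _ /mapP[b _ ->]; rewrite !inE.
case/or4P=> [/eqP->|/eqP->|/eqP->|]; last case/or4P=> /eqP->.
- exact/move_sound/ZigzagL.
- exact/move_sound/ZigzagR.
- by rewrite /sound /= value_qint mul1r addr0; apply: MOY_circle.
- exact: loop_below.
- exact: loop_above.
- rewrite /sound /= value_qint mul0r add0r.
  exact: (MOY_parallel_bigon R_MOY).
rewrite /sound /= value_qint value_one mul1r.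
exact: (MOY_antiparallel_bigon R_MOY).
Qed.

Lemma slides_sound r : r \in slides -> sound r.
Proof.
case/flattenP=> _ /allpairsP[[[a x] [c d]] [_ _ ->]]; rewrite !inE.
by case/predU1P=> [->|/eqP ->]; apply: move_sound; [apply: SlideCup | apply: SlideCap].
Qed.

Lemma reduces_one w v : same w v -> reduces_to w [:: (sone, v)].
Proof.
move=> wv s t psi skein_psi typed_w _.
rewrite /combo_val big_seq1 value_one mul1r.
by have [] := wv _ _ _ skein_psi typed_w.
Qed.

Lemma rewrite_onceP w C : rewrite_once w = Some C -> reduces_to w C.
Proof.
rewrite /rewrite_once; case E: (adjacent _ _) => [D|].
  case=> <-; apply: adjacentP E => -[|l v] // D' red_v.
  have [u /fronts_same /(same_cons (l := l)) vu red_u] := first_someP red_v.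
  have [r /reductions_sound sound_r app_r] := first_someP red_u.
  exact: same_reduces vu (apply_ruleP sound_r app_r).
case E': (adjacent _ _) => [D|].
  case=> <-; apply: adjacentP E' => v D' slide_v.
  have [r /slides_sound sound_r app_r] := first_someP slide_v.
  exact: apply_ruleP sound_r app_r.
apply: adjacentP => -[|[i g] [|[j h] v]] // D; rewrite /sort_at.
case: ifP => // _; case E2: (swap _) => [u|] // [<-].
exact/reduces_one/swap_same.
Qed.

Lemma normal_formP fuel s t psi w : skein_functional R s psi -> typed s t w ->
  psi w = combo_val psi (normal_form fuel s w).
Proof.
move=> skein_psi; have base v : psi v = combo_val psi [:: (sone, v)].
  by rewrite /combo_val big_seq1 value_one mul1r.
elim: fuel w => [|fuel IH] w typed_w //=; case E: (rewrite_once w) => [C|] //.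
case: ifP => // typed_C.
have {}typed_C : all (fun x => typed s t x.2) C.
  by case/andP: typed_w typed_C => /eqP ->.
rewrite (rewrite_onceP E skein_psi typed_w typed_C) /combo_val big_allpairs_dep.
rewrite big_seq [RHS]big_seq; apply: eq_bigr => x /(allP typed_C) typed_x.
rewrite IH // /combo_val big_distrr; apply: eq_bigr => y _.
by rewrite /= value_mul mulrA.
Qed.

Lemma normaliseP s psi C : skein_functional R s psi ->
  all (fun x => run negb s x.2 != None) C -> all (fun x => all good x.2) C ->
  combo_val psi C = combo_val psi (normalise s C).
Proof.
move=> skein_psi run_C good_C; rewrite /combo_val [RHS]big_allpairs_dep.
rewrite big_seq [RHS]big_seq; apply: eq_bigr => x in_x.
case E: (run negb s x.2) (allP run_C x in_x) => [t|] // _.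
rewrite (@normal_formP 40 s t) //; last by rewrite /typed E eqxx (allP good_C).
rewrite /combo_val big_distrr; apply: eq_bigr => y _.
by rewrite /= value_mul mulrA.
Qed.

Lemma sub_inv_eq0 (F : fieldType) (z : F) : z != 0 -> z - z^-1 = 0 -> z ^+ 2 = 1.
Proof. by move=> z_neq0 /subr0_eq def_z; rewrite expr2 {2}def_z mulfV. Qed.

Lemma den_neq0 : q - q^-1 != 0.
Proof.
apply/eqP=> /(sub_inv_eq0 q_neq0); rewrite /q -tofracXn -tofrac1.
move/eqP; rewrite tofrac_eq => /eqP/(congr1 (fun p : {poly int} => size p)).
by rewrite size_polyXn size_poly1.
Qed.

Lemma cancelsP psi C : cancels C -> combo_val psi C = 0.
Proof.
case/andP=> /allP le_C /allP zero_C.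
apply: (mulIf (expf_neq0 4 den_neq0)); rewrite mul0r.
rewrite /combo_val (sum_by_key snd) big_distrl big1_seq // => w /andP[_ in_w].
transitivity (lval q (q ^ n%:Z) (flatten [seq numerator x.1 | x <- C & x.2 == w])
  * psi w); last by rewrite (lzeroP _ _ (zero_C w in_w)) mul0r.
rewrite lval_flatten big_map big_filter !big_distrl big_seq_cond.
rewrite [RHS]big_seq_cond; apply: eq_bigr => x /andP[in_x /eqP <-].
rewrite -(weight_val_numerator q_neq0 qn_neq0 den_neq0 (le_C x in_x)) /=.
by rewrite mulrAC.
Qed.

Lemma combo_val_cat psi C1 C2 :
  combo_val psi (C1 ++ C2) = combo_val psi C1 + combo_val psi C2.
Proof. exact: big_cat. Qed.

Lemma weight_expand (F : fieldType) (z : F) (m e r : int) : z != 0 ->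
  z ^ e * (z ^ (1 - m)) ^ r = z ^ (e + r) * (z ^ m) ^ (- r).
Proof.
move=> z_neq0; rewrite !exprz_exp -!expfzDr //; congr (z ^ _); ring.
Qed.

Lemma value_weight e r :
  value (smonom 1 (e + r) (- r)) = q ^ e * (q ^ (1 - n%:Z)) ^ r.
Proof. by rewrite /value weight_val_monom mul1r (weight_expand _ _ _ q_neq0). Qed.

Lemma state_combo_val s psi D :
  \sum_(x <- D) value x.1 * state_sum n s psi x.2 = combo_val psi (state_combo s D).
Proof.
rewrite /combo_val big_allpairs_dep; apply: eq_bigr => x _.
rewrite /state_sum big_distrr; apply: eq_bigr => y _ /=.
by rewrite value_mul value_weight -[RHS]mulrA.
Qed.

(** The local principle. The extra terms [corr s] make room for relations that
    have no preferred direction and are not used as rewriting rules. *)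
Theorem evaluation_by_computation (E : exterior unit) m s0 (D : seq (weight * graph))
    (corr : seq bool -> combo) :
  run id [::] (below E) = Some s0 -> (left E + m <= size s0)%N ->
  all (fun x => run id (nseq m tt) x.2 != None) D ->
  (forall s psi, size s = m -> skein_functional R s psi ->
     combo_val psi (corr s) = 0) ->
  (forall s, size s = m ->
    let C := state_combo s D ++ corr s in
    [&& all (fun x => run negb s x.2 != None) C, all (fun x => all good x.2) C
      & cancels (normalise s C)]) ->
  \sum_(x <- D) value x.1 * evaluation n R (plug E x.2) = 0.
Proof.
move=> run_E le_m fits_D corr0 check.
have := @evaluation_local n R E m s0 [seq (value x.1, x.2) | x <- D] run_E le_m.
rewrite all_map big_map; apply=> // s psi sz_s skein_psi.
rewrite big_map /= state_combo_val.
have /and3P[run_C good_C cancel_C] := check s sz_s.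
have: combo_val psi (state_combo s D ++ corr s) = 0.
  by rewrite (normaliseP skein_psi run_C good_C); apply: cancelsP.
by rewrite combo_val_cat corr0 // addr0.
Qed.

End Soundness.
(** * Planar isotopy invariance of the evaluation *)

Section Isotopy.
Variables (n : nat) (R : ograph -> coef).
Hypothesis R_MOY : MOY_polynomial n R.

Lemma same_letter_word s t i g v c w : typed s t [:: (i, g)] ->
  same R ((i, g) :: shift (size t + c) v ++ w)
         (shift (size s + c) v ++ (i, g) :: w).
Proof.
move=> typed_g; elim: v => [|[j h] v IH] /=; first exact: same_refl.
have /andP[/eqP run_g _] := typed_g; move: run_g => /=.
case E: (layer _ _ _) => [t'|] // [eq_t]; rewrite {}eq_t in E.
have /eqP/layerP[p [r [sz_p def_s def_t]]] := E.
have -> : (size t + c + j = i + size (top negb g) + (size r + c + j))%N.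
  by rewrite def_t !size_cat -sz_p !addnA.
apply: same_trans (@same_exchange n R R_MOY i (size r + c + j) g h _) _.
have -> : (i + size (bottom negb g) + (size r + c + j) = size s + c + j)%N.
  by rewrite def_s !size_cat -sz_p !addnA.
exact: same_cons.
Qed.

Lemma same_words s t u v c : typed s t u ->
  same R (u ++ shift (size t + c) v) (shift (size s + c) v ++ u).
Proof.
elim: u s => [|[i g] u IH] s.
  by case/andP=> /eqP[<-] _; rewrite cats0; apply: same_refl.
case/typed_cons=> s' typed_g typed_u.
apply: (@same_trans _ _ ((i, g) :: shift (size s' + c) v ++ u)).
  exact/same_cons/IH.
exact: (@same_letter_word _ _ _ _ v c u typed_g).
Qed.

Lemma layer_at pre s post h : size s = size (bottom negb h) ->
  layer negb (pre ++ s ++ post) (size pre, h)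
  = if s == bottom negb h then Some (pre ++ top negb h ++ post) else None.
Proof.
move=> sz_s; case: eqP => [->|ne_s]; first exact: layerE.
case E: (layer _ _ _) => [t|] //; have /eqP/layerP[p [r [sz_p]]] := E.
move/eqP; rewrite eqseq_cat // => /andP[_]; rewrite eqseq_cat //.
by case/andP=> /eqP.
Qed.

(** States by their exponent of [q] and their word only, which is all that two
    pieces side by side need to know of each other. *)
Definition piece_states (s : seq bool) (g : gen unit) : seq (int * ograph) :=
  flatten [seq resolutions 0 h
             | h <- gen_orientations g & balanced h && (s == bottom negb h)].

Lemma piece_states_typed s g r : r \in piece_states s g ->
  exists2 t, typed s t r.2 & size t = size (top id g).
Proof.
case/flattenP=> _ /mapP[h + ->] in_r; rewrite mem_filter.
case/andP=> /andP[bal_h /eqP def_s] in_h.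
exists (top negb h); last by have [_] := size_bottom in_h.
apply: resolutions_typed in_r => //.
by have := layerE negb [::] [::] h; rewrite def_s !cats0.
Qed.

Lemma big_piece_states (V : nmodType) pre s post g G (F H : int * ograph -> V) :
  size s = size (bottom id g) ->
  (forall t r, size t = size (top id g) ->
     \sum_(x <- states (pre ++ t ++ post) G) F (r.1 + x.2.1, r.2 ++ x.2.2) = H r) ->
  \sum_(x <- states (pre ++ s ++ post) ((size pre, g) :: G)) F x.2
  = \sum_(r <- piece_states s g) H (r.1, shift (size pre) r.2).
Proof.
move=> sz_s sumG; rewrite big_states_cons /piece_states.
rewrite [RHS]big_flatten [RHS]big_map [RHS]big_filter.
rewrite big_seq_cond [RHS]big_seq_cond [LHS]big_mkcond [RHS]big_mkcond.
apply: eq_bigr => h _; case: (boolP (h \in _)) => //= in_h.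
case: (balanced h) => //=; have [sz_b sz_t] := size_bottom in_h.
rewrite layer_at ?sz_b //; case: ifP => // _.
rewrite -[in LHS](addn0 (size pre)) resolutions_shift big_map.
by apply: eq_bigr => r _ /=; rewrite -(sumG (top negb h)).
Qed.

Lemma big_last_piece (V : nmodType) pre s post g (F : int * ograph -> V) :
  size s = size (bottom id g) ->
  \sum_(x <- states (pre ++ s ++ post) [:: (size pre, g)]) F x.2
  = \sum_(r <- piece_states s g) F (r.1, shift (size pre) r.2).
Proof.
move=> sz_s; apply: big_piece_states => // t [e w] _.
by rewrite big_states_nil /= addr0 cats0.
Qed.

(** Pieces that are side by side have independent states, whose words can be
    put at either height. *)
Lemma state_sum_exchange psi sg mid sh g h :
  skein_functional R (sg ++ mid ++ sh) psi ->
  size sg = size (bottom id g) -> size sh = size (bottom id h) ->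
  state_sum n (sg ++ mid ++ sh) psi [:: (0%N, g); ((size (top id g) + size mid)%N, h)]
  = state_sum n (sg ++ mid ++ sh) psi
      [:: ((size (bottom id g) + size mid)%N, h); (0%N, g)].
Proof.
move=> skein_psi sz_g sz_h.
pose F (y : int * ograph) :=
  q ^ y.1 * (q ^ (1 - n%:Z)) ^ (turning y.2 %/ 2)%Z * psi y.2.
rewrite /state_sum.
rewrite (@big_piece_states _ [::] sg (mid ++ sh) g _ F (fun r =>
  \sum_(y <- piece_states sh h)
     F (r.1 + y.1, r.2 ++ shift (size (top id g) + size mid) y.2))) //; last first.
  move=> t r sz_t; rewrite -sz_t -size_cat [t ++ _]catA.
  have := big_last_piece (t ++ mid) [::] (fun y => F (r.1 + y.1, r.2 ++ y.2)) sz_h.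
  by rewrite cats0.
have -> : sg ++ mid ++ sh = (sg ++ mid) ++ sh ++ [::] by rewrite cats0 -catA.
rewrite -sz_g -size_cat.
rewrite (@big_piece_states _ (sg ++ mid) sh [::] h _ F (fun y =>
  \sum_(r <- piece_states sg g) F (y.1 + r.1, y.2 ++ r.2))) //; last first.
  move=> t y _; rewrite cats0 -catA.
  rewrite (big_last_piece [::] _ (fun r => F (y.1 + r.1, y.2 ++ r.2))) //.
  by apply: eq_bigr => r _; rewrite shift0.
rewrite exchange_big big_seq [RHS]big_seq; apply: eq_bigr => y in_y /=.
rewrite big_seq [RHS]big_seq; apply: eq_bigr => r in_r; rewrite shift0 /F /=.
have [t typed_r sz_t] := piece_states_typed in_r.
have [t' typed_y _] := piece_states_typed in_y.
rewrite [r.1 + _]addrC !turning_cat !turning_shift [turning r.2 + _]addrC.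
congr (_ * _).
have typed_ry : typed (sg ++ mid ++ sh) (t ++ mid ++ t')
    (r.2 ++ shift (size t + size mid) y.2).
  apply: (@typed_cat _ (t ++ mid ++ sh)).
    by have := typed_frame [::] (mid ++ sh) typed_r; rewrite shift0.
  rewrite -size_cat !(catA t).
  by have := typed_frame (t ++ mid) [::] typed_y; rewrite !cats0.
have [_] := @same_words sg t r.2 y.2 (size mid) typed_r _ _ _ skein_psi typed_ry.
by rewrite sz_t size_cat.
Qed.

Lemma strands_needed l k bg tg bh N : (l + 0 + bg <= N)%N ->
  (l + (tg + k) + bh <= N + tg - bg)%N -> (l + (bg + k + bh) <= N)%N.
Proof. by lia. Qed.

(** Except for exchanges, each move is one of finitely many local identities. *)
Lemma evaluation_move E X Y : move id X Y ->
  Defs.closed id (plug E X) -> Defs.closed id (plug E Y) ->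
  evaluation n R (plug E X) = evaluation n R (plug E Y).
Proof.
move=> XY closed_X closed_Y.
have [s0 run_E run_X] : exists2 s0, run id [::] (below E) = Some s0 &
    run id s0 (shift (left E) X) != None.
  move: closed_X; rewrite /Defs.closed /plug run_cat.
  case: (run _ _ _) => [s0|] //; rewrite run_cat; case E1: (run _ _ _) => [s1|] // _.
  by exists s0; rewrite ?E1.
have check m : (left E + m <= size s0)%N ->
    run id (nseq m tt) X != None -> run id (nseq m tt) Y != None ->
    (forall s, size s = m ->
      let C := state_combo s [:: (sone, X); (sminus, Y)] in
      [&& all (fun x => run negb s x.2 != None) C, all (fun x => all good x.2) C
        & cancels (normalise s C)]) ->
    evaluation n R (plug E X) = evaluation n R (plug E Y).
  move=> le_m run_mX run_mY check.
  have := @evaluation_by_computation n R R_MOY E m s0 [:: (sone, X); (sminus, Y)]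
    (fun=> [::]) run_E le_m.
  rewrite /= run_mX run_mY big_cons big_seq1 /= value_one value_minus mul1r mulN1r.
  move=> eq0; apply/subr0_eq/eq0 => //.
    by move=> s psi _ _; rewrite /combo_val big_nil.
  by move=> s sz_s; rewrite cats0; apply: check.
case: XY run_X check => [k g h|[]|[]|[] [] [] []|[] [] [] []].
- move=> run_X _; set T := size (top id g) in run_X *.
  set B := size (bottom id g).
  have le_m : (left E + (B + k + size (bottom id h)) <= size s0)%N.
    move: run_X => /=; case E1: (layer _ _ _) => [s1|] //=.
    case E2: (layer _ _ _) => [s2|] // _; have [le1 sz1] := layer_unit E1.
    have [le2 _] := layer_unit E2; rewrite sz1 in le2.
    exact: strands_needed le1 le2.
  have fits : (run id (nseq (B + k + size (bottom id h)) tt)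
      [:: (0%N, g); ((T + k)%N, h)] != None) &&
    (run id (nseq (B + k + size (bottom id h)) tt)
      [:: ((B + k)%N, h); (0%N, g)] != None).
    have -> : nseq (B + k + size (bottom id h)) tt
        = bottom id g ++ nseq k tt ++ bottom id h.
      by rewrite [RHS]nseq_unit !size_cat size_nseq addnA.
    apply/andP; split.
      rewrite /= (layerE id [::] (nseq k tt ++ bottom id h) g) /=.
      have := layerE id (top id g ++ nseq k tt) [::] h.
      by rewrite !cats0 -!catA size_cat size_nseq => ->.
    have := layerE id (bottom id g ++ nseq k tt) [::] h.
    rewrite !cats0 -!catA size_cat size_nseq /= => -> /=.
    by rewrite (layerE id [::] (nseq k tt ++ top id h) g).
  have /andP[fits_X fits_Y] := fits.
  have := @evaluation_local n R E _ s0
    [:: (1, [:: (0%N, g); ((T + k)%N, h)]); (- 1, [:: ((B + k)%N, h); (0%N, g)])]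
    run_E le_m.
  rewrite /= -/(run id _ [:: (0%N, g); ((T + k)%N, h)]).
  rewrite -/(run id _ [:: ((B + k)%N, h); (0%N, g)]) fits_X fits_Y.
  rewrite big_cons big_seq1 /= mul1r mulN1r => eq0; apply/subr0_eq/eq0 => //.
  move=> s psi sz_s skein_psi; rewrite big_cons big_seq1 /= mul1r mulN1r.
  have def_s : s = take B s ++ take k (drop B s) ++ drop k (drop B s).
    by rewrite !cat_take_drop.
  rewrite def_s in skein_psi *.
  have := state_sum_exchange skein_psi.
  rewrite !size_takel ?size_drop; try lia.
  by rewrite -/T -/B sz_s => ->; rewrite ?subrr //; lia.
- move=> run_X check; apply: (check 1%N) => //; last by case=> [|[] []].
  move: run_X => /=; case E1: (layer _ _ _) => [s1|] // _.
  by have [] := layer_unit E1; rewrite addn0.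
- move=> run_X check; apply: (check 1%N) => //; last by case=> [|[] []].
  move: run_X => /=; case E1: (layer _ _ _) => [s1|] //=.
  case E2: (layer _ _ _) => [s2|] // _.
  by have [_ sz1] := layer_unit E1; have [] := layer_unit E2; rewrite sz1 /=; lia.
- move=> run_X check; apply: (check 1%N) => //; last by case=> [|[] []].
  move: run_X => /=; case E1: (layer _ _ _) => [s1|] // _.
  by have [] := layer_unit E1; rewrite addn0.
move=> run_X check; apply: (check 3%N) => //.
  move: run_X => /=; case E1: (layer _ _ _) => [s1|] // _.
  by have [] := layer_unit E1; rewrite -addnA.
by case=> [|[] [|[] [|[] []]]].
Qed.

Lemma evaluation_isotopic G1 G2 :
  isotopic id G1 G2 -> evaluation n R G1 = evaluation n R G2.
Proof.
elim=> // [E X Y XY closed_X closed_Y|w1 w2 w3 _ -> //].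
exact: evaluation_move.
Qed.

End Isotopy.
(** * The relation of the triangles *)

Definition braid_relation (b : bool) : combo :=
  let E1 := (0%N, Vert b b b b) in
  let E2 := (1%N, Vert b b b b) in
  [:: (sone, [:: E1; E2; E1]); (sone, [:: E2]);
      (sminus, [:: E2; E1; E2]); (sminus, [:: E1])].

Definition cycle_relation (b : bool) : combo :=
  let v := Vert (~~ b) b b (~~ b) in
  let v' := Vert b (~~ b) (~~ b) b in
  [:: (sone, [:: (0%N, Cup (~~ b)); (1%N, Cup b); (3%N, Cup b);
                 (0%N, v); (2%N, v); (4%N, v)]);
      (sqint 1 (- 3), [:: (0%N, Cup b); (1%N, Cup (~~ b)); (3%N, Cup (~~ b))]);
      (sminus, [:: (0%N, Cup b); (2%N, Cup b); (1%N, v); (2%N, Cup (~~ b));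
                   (1%N, v'); (3%N, v')]);
      (smul sminus (sqint 1 (- 3)), [:: (0%N, Cup b); (2%N, Cup b); (4%N, Cup b)])].

(** The relation [C] with [P] below, [Q] above and [i] strands on its left. The
    power of [q ^ (1 - n)] is the one that the first word gets in [state_combo],
    because this word is, up to isotopy, also a state of one of the two
    triangles, whose coefficient in [disk_relation] is [- sign]. *)
Definition in_disk (sign : int) (P : ograph) (i : nat) (Q : ograph) (C : combo) :
    combo :=
  let words := [seq (x.1, P ++ shift i x.2 ++ Q) | x <- C] in
  let r := (turning (head (sone, [::]) words).2 %/ 2)%Z in
  [seq (smul (smonom sign r (- r)) x.1, x.2) | x <- words].

(** Three nested cups on top of each other give the three-strand relation six
    top ends, of which [k] cups and caps around it move the first [k] ones to
    the right end. Turning by one sixth exchanges the two triangles, hence the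
    sign; three sixths reverse the orientation, so that [k < 3] is enough. *)
Definition turned_braid_relation (b : bool) (k : nat) : combo :=
  in_disk ((-1) ^+ k.+1)
    ([seq (j, Cup (~~ b)) | j <- iota 0 k] ++ [seq (j, Cup b) | j <- iota k 3]) k
    (rev [seq (j, Cap (~~ b)) | j <- iota 0 k]) (braid_relation b).

Definition triangle_relations (s : seq bool) : combo :=
  flatten [seq in_disk (- 1) [::] 0 [::] (cycle_relation b) | b <- [:: true; false]]
  ++ flatten [seq turned_braid_relation b k | b <- [:: true; false], k <- iota 0 3].

Definition disk_relation : seq (weight * graph) :=
  let c := sqint 2 (- 4) in
  [:: (sone, tangle_T); (sone, tangle_V45); (sminus, tangle_V34);
      (sminus, tangle_V56); (smul sminus c, tangle_M);
      (sminus, tangle_T'); (sminus, tangle_V12); (sone, tangle_V23);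
      (sone, tangle_V61); (c, tangle_M')].

(** All orientations of the boundary points are treated together, since a word
    determines the labels of its top ends. *)
Lemma disk_relation_cancels :
  let C := state_combo [::] disk_relation ++ triangle_relations [::] in
  [&& all (fun x => run negb [::] x.2 != None) C, all (fun x => all good x.2) C
    & cancels (normalise [::] C)].
Proof. by vm_compute. Qed.

Section Triangles.
Variables (n : nat) (R : ograph -> coef).
Hypothesis R_MOY : MOY_polynomial n R.

Lemma braid_relation_null b : local_relation R (values n (braid_relation b)) [::].
Proof.
move=> E cross; have := @MOY_three_strands _ _ R_MOY b E.
rewrite /= in cross *; case/and5P: cross => -> -> -> -> _ /(_ isT).
rewrite !big_cons !big_nil /= value_one value_minus !mulN1r !mul1r !addr0 => eq_sums.
by rewrite addrA eq_sums -opprD subrr.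
Qed.

Lemma cycle_relation_null b : local_relation R (values n (cycle_relation b)) [::].
Proof.
move=> E cross; have := @MOY_triangle _ _ R_MOY b E.
rewrite /= in cross *; case/and5P: cross => -> -> -> -> _ /(_ isT).
rewrite !big_cons !big_nil /= value_mul value_one value_minus value_qint mul1r.
rewrite !mulN1r !mul1r !addr0 => eq_sums.
by rewrite addrA eq_sums mulNr -!opprD subrr.
Qed.

Lemma in_disk_val psi t sign P i Q C : skein_functional R [::] psi ->
  local_relation R (values n C) [::] ->
  all (fun x => typed [::] t (P ++ shift i x.2 ++ Q)) C ->
  combo_val n psi (in_disk sign P i Q C) = 0.
Proof.
move=> skein_psi null_C typed_C; rewrite /combo_val !big_map.
under eq_bigr do rewrite /= value_mul // -mulrA.
rewrite -big_distrr; have := skein_psi i P Q t _ _ null_C.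
rewrite /values big_map big_nil cats0 all_map => /(_ typed_C) /= ->.
exact: mulr0.
Qed.

Lemma triangle_relations_val s psi :
  size s = 0%N -> skein_functional R s psi ->
  combo_val n psi (triangle_relations s) = 0.
Proof.
case: s => // _ skein_psi; rewrite /triangle_relations combo_val_cat /combo_val.
rewrite big_flatten big_map [X in _ + X]big_flatten big_allpairs_dep.
rewrite big1 => [|b _]; last first.
  apply: (@in_disk_val _ [:: b; ~~ b; b; ~~ b; b; ~~ b]) => //.
    exact: cycle_relation_null.
  by case: b.
rewrite big1 ?addr0 // => b _; rewrite big1_seq // => k; rewrite mem_iota => lt_k.
apply: (@in_disk_val _ (rot k [:: b; b; b; ~~ b; ~~ b; ~~ b])) => //.
  exact: braid_relation_null.
by case: b; case: k lt_k => [|[|[|]]].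
Qed.

End Triangles.

Lemma rearrange (A : comPzRingType) (t v45 v34 v56 m t' v12 v23 v61 m' c : A) :
  1 * t + (1 * v45 + (-1 * v34 + (-1 * v56 + (-1 * c * m + (-1 * t' + (-1 * v12
    + (1 * v23 + (1 * v61 + c * m')))))))) = 0 ->
  t + v45 - v34 - v56 - c * m = t' + v12 - v23 - v61 - c * m'.
Proof. by move=> eq0; apply/subr0_eq; rewrite -[RHS]eq0; ring. Qed.

Theorem proposition4 (n : nat) (n_ge2 : (2 <= n)%N)
    (R : ograph -> coef) (R_MOY : MOY_polynomial n R)
    (E : exterior unit)
    (T T' M M' V12 V23 V34 V45 V56 V61 : graph)
    (hT : looks_like E tangle_T T) (hT' : looks_like E tangle_T' T')
    (hM : looks_like E tangle_M M) (hM' : looks_like E tangle_M' M')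
    (hV12 : looks_like E tangle_V12 V12) (hV23 : looks_like E tangle_V23 V23)
    (hV34 : looks_like E tangle_V34 V34) (hV45 : looks_like E tangle_V45 V45)
    (hV56 : looks_like E tangle_V56 V56) (hV61 : looks_like E tangle_V61 V61) :
  evaluation n R T + evaluation n R V45 - evaluation n R V34
    - evaluation n R V56 - qint ((2 * n)%N%:Z - 4) * evaluation n R M
  = evaluation n R T' + evaluation n R V12 - evaluation n R V23
    - evaluation n R V61 - qint ((2 * n)%N%:Z - 4) * evaluation n R M'.
Proof.
have evalE X G : looks_like E X G -> evaluation n R G = evaluation n R (plug E X).
  by case=> _ /(evaluation_isotopic R_MOY).
rewrite (evalE _ _ hT) (evalE _ _ hT') (evalE _ _ hM) (evalE _ _ hM').
rewrite (evalE _ _ hV12) (evalE _ _ hV23) (evalE _ _ hV34) (evalE _ _ hV45).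
rewrite (evalE _ _ hV56) (evalE _ _ hV61).
have [s0 run_E le_E] : exists2 s0, run id [::] (below E) = Some s0 &
    (left E + 0 <= size s0)%N.
  case: hM => + _; rewrite /Defs.closed /plug run_cat.
  case: (run _ _ _) => [s0|] //; rewrite /=; case E1: (layer _ _ _) => [s1|] // _.
  by exists s0; last by have [] := layer_unit E1; rewrite /= !addn0.
have := @evaluation_by_computation n R R_MOY E 0 s0 disk_relation
  triangle_relations run_E le_E isT.
rewrite !big_cons big_nil /= value_mul value_one value_minus value_qint.
rewrite -PoszM addr0 => local; apply: rearrange; apply: local.
  exact: triangle_relations_val.
by move=> s /size0nil ->; exact: disk_relation_cancels.
Qed.
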